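(* In the ring of formal power series $\mathbb{C}[[\underline s,\underline t]]$ in the indeterminates $\underline s=(s_i)_{i\ge1}$ and $\underline t=(t_j)_{j\ge 1}$, \[ \sum_{n \ge 0} \sum_{\lambda \vdash n} \sum_{\nu \vdash n} \operatorname{sign}(\nu)\,\psi_{S_n}^\lambda(\nu)\, \frac{\underline s^{c(\lambda)} \underline t^{c(\nu)}}{|Z_\nu|} = \exp \left( \sum_{i\ge1} \sum_{j\ge1} \sum_{e \mid \gcd(i,j)} (-1)^{i(j-1)/e} \mu(e)\, \frac{s_{i}^{j/e} t_{j}^{i/e}}{ij/e} \right), \] where $\mu(\cdot)$ is the classical Möbius function.
   Context: For $\lambda\vdash n$ with $a_i$ parts of size $i$ and $\nu\vdash n$ with $b_j$ parts of size $j$, $\underline s^{c(\lambda)} := \prod_i s_i^{a_i}$ and $\underline t^{c(\nu)} := \prod_j t_j^{b_j}$. $|Z_\nu|=\prod_j b_j!\,j^{b_j}$ is the size of the centralizer in $S_n$ of an element of cycle type $\nu$, and $\operatorname{sign}(\nu)$ is the sign of a permutation of cycle type $\nu$. $\psi(\nu)$ denotes the value of the character $\psi$ on elements of cycle type $\nu$. The $n=0$ term of the sum equals $1$. The exponent $i(j-1)/e$ means $(i/e)(j-1)$, an integer. Higher Lie characters of $S_n$: let $\lambda \vdash n$ have $a_i$ parts of size $i$ ($i\ge 1$), and let $x \in S_n$ have cycle type $\lambda$. Write $x=\prod_i x_i$ where $x_i$ is the product of the $a_i$ cycles of $x$ of length $i$. The centralizer is $Z_x = Z_{S_n}(x) =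 \prod_i Z_{S_{ia_i}}(x_i) \cong \prod_i G_i \wr S_{a_i}$, with $G_i$ cyclic of order $i$. Concretely, label the $ia_i$ points lying in cycles of length $i$ by $(r,t)$, $1\le r\le a_i$, $t \in \mathbb{Z}/i\mathbb{Z}$, so that $x(r,t)=(r,t+1)$; every element $z_i\in Z_{S_{ia_i}}(x_i)$ has the form $z_i(r,t)=(\sigma(r),t+k_r)$ with $\sigma\in S_{a_i}$, $k_r\in\mathbb{Z}/i\mathbb{Z}$. Let $\omega_i$ be the linear character that is a primitive (faithful) irreducible character on the cyclic group $G_i$ and trivial on $S_{a_i}$, i.e. $\omega_i(z_i)=\prod_r \zeta_i^{k_r}$ with $\zeta_i$ a primitive complex $i$-th root of unity. Let $\omega^x := \bigotimes_i \omega_i$, a linear character of $Z_x$. The higher Lie character is the induced character $\psi_{S_n}^\lambda = \psi_{S_n}^x := \omega^x\uparrow_{Z_x}^{S_n}$; it depends only on $\lambda$. *)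

(* Defs.v *)
From HB Require Import structures.
From mathcomp Require Import all_boot all_order all_algebra all_fingroup.
From mathcomp Require Import all_solvable all_field all_character.
From mathcomp Require Import finmap multiset.
From mathcomp Require Import boolp classical_sets functions cardinality fsbigop.

Set Implicit Arguments.
Unset Strict Implicit.
Unset Printing Implicit Defensive.

Import Order.TTheory GRing.Theory Num.Theory.
Local Open Scope mset_scope.
Local Open Scope classical_set_scope.
Local Open Scope ring_scope.

(* Formal power series over R in the indeterminates indexed by I: a monomial
   is a finite multiset of indices, and a series is its coefficient function. *)
Definition fps (I : choiceType) (R : comNzRingType) : Type := {mset I} -> R.

(* Locked so that unification never unfolds products of series. *)
HB.lock Definition fps_mul (I : choiceType) (R : comNzRingType)
    (f g : fps I R) : fps I R := fun m =>
  \sum_(p \in [set p : {mset I} * {mset I} | (p.1 `+` p.2)%mset = m])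
     f p.1 * g p.2.

Section FpsRing.
Variables (I : choiceType) (R : comNzRingType).
Implicit Types (f g h : fps I R) (m a b c : {mset I}).

HB.instance Definition _ := GRing.Zmodule.copy (fps I R) ({mset I} -> R).

Lemma fpsP f g : (forall m, f m = g m) -> f = g.
Proof. by move=> fg; apply/funext. Qed.

Lemma finite_msubset m : finite_set [set a : {mset I} | (a `<=` m)%mset].
Proof.
rewrite -[m]seq_mset_id; elim: (m : seq I) => [|x s IH].
  apply: (@sub_finite_set _ _ [set mset0]) => [a /=|]; last exact: finite_set1.
  move=> /msubsetP le0; apply/msetP => i; apply/eqP.
  by have := le0 i; rewrite mset_seqE /= leqn0 mset0E.
pose B := [set a : {mset I} | (a `<=` seq_mset s)%mset].
apply: (@sub_finite_set _ _ (B `|` [set (x +` a)%mset | a in B])); last first.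
  by rewrite finite_setU; split=> //; apply: finite_image.
move=> a /= /msubsetP leax; case: (boolP (x \in a)) => [xa|xNa]; [right|left].
  exists (a `\ x)%mset; last by rewrite msetB1K.
  apply/msubsetP => i; rewrite msetB1E; have := leax i.
  by rewrite mset_cons mset1DE leq_subLR.
apply/msubsetP => i; have := leax i; rewrite mset_cons mset1DE.
by case: eqP => // ->; rewrite (mset_eq0P xNa).
Qed.

Let divs m : {fset {mset I}} := fset_set [set a : {mset I} | (a `<=` m)%mset].

Let mem_divs m a : (a \in divs m) = (a `<=` m)%mset.
Proof.
rewrite in_fset_set; last exact: finite_msubset.
by apply/idP/idP => [/set_mem//|?]; apply/mem_set.
Qed.

Lemma finite_mset_split m :
  finite_set [set p : {mset I} * {mset I} | (p.1 `+` p.2)%mset = m].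
Proof.
pose B := [set a : {mset I} | (a `<=` m)%mset].
apply: (@sub_finite_set _ _ (B `*` B)).
  by move=> [a b] /= eab; split; apply/msubsetP => i;
    rewrite -eab msetE2 ?leq_addr ?leq_addl.
by apply: finite_setX; apply: finite_msubset.
Qed.

Let mulE m f g m' : (m' `<=` m)%mset -> fps_mul f g m' =
  \sum_(a <- divs m) \sum_(b <- divs m | (a `+` b)%mset == m') f a * g b.
Proof.
move=> lem; rewrite fps_mul.unlock pair_big_dep_cond /= -big_filter.
rewrite big_filter [RHS]fsbig_seq ?fset_uniq//.
apply: eq_fsbigl; apply/seteqP; split=> [[a b] /= eab|[a b]] /=.
  have lea x : (x `<=` m')%mset -> (x `<=` m)%mset.
    by move=> /msubset_trans; apply.
  apply/imfset2P; exists a; first by rewrite !inE /= mem_divs andbT lea// -eab;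
    apply/msubsetP => i; rewrite msetE2 leq_addr.
  exists b => //; rewrite !inE /= mem_divs eab eqxx andbT lea// -eab.
  by apply/msubsetP => i; rewrite msetE2 leq_addl.
move=> /imfset2P[a' _ [b' + [-> ->]]].
by rewrite !inE /= => /andP[_ /eqP].
Qed.

Let mul_bigE m f g m' : (m' `<=` m)%mset -> fps_mul f g m' =
  \sum_(a <- divs m) \sum_(b <- divs m) (f a * g b) *+ ((a `+` b)%mset == m').
Proof.
move=> lem; rewrite (mulE _ _ lem); apply: eq_bigr => a _.
by rewrite big_mkcond; apply: eq_bigr => b _; case: eqP.
Qed.

Let sum_delta m a (F : {mset I} -> R) : (a `<=` m)%mset ->
  \sum_(b <- divs m) F b *+ (b == a) = F a.
Proof.
move=> lem; rewrite (bigD1_seq a) ?mem_divs ?fset_uniq//= eqxx.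
by rewrite big1 ?addr0// => b /negPf->.
Qed.

Definition fps_one : fps I R := fun m => (m == mset0)%:R.

Lemma fps_mulC : commutative (@fps_mul I R).
Proof.
move=> f g; apply: fpsP => m; rewrite !(@mul_bigE m) ?msubset_refl//.
rewrite exchange_big; apply: eq_bigr => a _; apply: eq_bigr => b _.
by rewrite msetDC mulrC.
Qed.

Lemma fps_mul1 : left_id fps_one (@fps_mul I R).
Proof.
move=> f; apply: fpsP => m; rewrite (@mul_bigE m) ?msubset_refl//.
transitivity (\sum_(a <- divs m)
    (\sum_(b <- divs m) f b *+ ((a `+` b)%mset == m)) *+ (a == mset0)).
  apply: eq_bigr => a _; rewrite -sumrMnl; apply: eq_bigr => b _.
  by rewrite /fps_one mulr_natl mulrnAC.
rewrite (sum_delta (fun a => \sum_(b <- divs m) f b *+ ((a `+` b)%mset == m)));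
  last by apply: msub0set.
by under eq_bigr do rewrite mset0D; rewrite sum_delta ?msubset_refl.
Qed.

Let mul3E m f g h : fps_mul (fps_mul f g) h m =
  \sum_(a <- divs m) \sum_(b <- divs m) \sum_(c <- divs m)
     (f a * g b * h c) *+ ((a `+` b `+` c)%mset == m).
Proof.
rewrite (@mul_bigE m) ?msubset_refl//.
transitivity (\sum_(u <- divs m) \sum_(a <- divs m) \sum_(b <- divs m)
   \sum_(c <- divs m)
     (f a * g b * h c) *+ ((a `+` b `+` c)%mset == m) *+ (u == (a `+` b)%mset)).
  apply: eq_big_seq => u; rewrite mem_divs => leu; rewrite (mul_bigE _ _ leu).
  under eq_bigr do rewrite mulr_suml -sumrMnl.
  rewrite exchange_big; apply: eq_bigr => a _.
  under eq_bigr do rewrite mulr_suml -sumrMnl.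
  rewrite exchange_big; apply: eq_bigr => b _; apply: eq_bigr => c _.
  by case: (eqVneq u (a `+` b)%mset) => [->|neu];
    rewrite ?eqxx ?mulr1n ?mulr0n ?mul0r ?mul0rn // mulrnAl.
rewrite exchange_big; apply: eq_bigr => a _.
rewrite exchange_big; apply: eq_bigr => b _.
rewrite exchange_big; apply: eq_bigr => c _.
case: (eqVneq (a `+` b `+` c)%mset m) => [em|_].
  rewrite mulr1n (sum_delta (fun=> f a * g b * h c))//.
  by apply/msubsetP => i; rewrite -em [X in (_ <= X)%N]msetE2 leq_addr.
by rewrite mulr0n big1// => u _; rewrite mul0rn.
Qed.

Lemma fps_mulA : associative (@fps_mul I R).
Proof.
move=> f g h; apply: fpsP => m.
rewrite mul3E (fps_mulC f) mul3E.
under eq_bigr do rewrite exchange_big /=.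
rewrite exchange_big /=; apply: eq_bigr => a _.
apply: eq_bigr => b _; apply: eq_bigr => c _.
by rewrite msetDC msetDA mulrC mulrA.
Qed.

Lemma fps_mulDl : left_distributive (@fps_mul I R) +%R.
Proof.
move=> f g h; apply: fpsP => m.
transitivity (fps_mul f h m + fps_mul g h m) => //.
rewrite !(@mul_bigE m) ?msubset_refl// -big_split /=.
apply: eq_bigr => a _; rewrite -big_split; apply: eq_bigr => b _ /=.
by rewrite -mulrnDl -mulrDl.
Qed.

Lemma fps_oner_neq0 : fps_one != 0.
Proof.
apply/eqP => /(congr1 (fun f : fps I R => f mset0))/eqP.
by rewrite /fps_one eqxx oner_eq0.
Qed.

HB.instance Definition _ := GRing.Zmodule_isComNzRing.Build (fps I R)
  fps_mulA fps_mulC fps_mul1 fps_mulDl fps_oner_neq0.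

Definition fps_scale (k : R) f : fps I R := fun m => k * f m.

Lemma fps_scaleA k l f : fps_scale k (fps_scale l f) = fps_scale (k * l) f.
Proof. by apply: fpsP => m; apply: mulrA. Qed.
Lemma fps_scale1 : left_id 1 fps_scale.
Proof. by move=> f; apply: fpsP => m; apply: mul1r. Qed.
Lemma fps_scaleDr : right_distributive fps_scale +%R.
Proof. by move=> k f g; apply: fpsP => m; apply: mulrDr. Qed.
Lemma fps_scaleDl f : {morph fps_scale^~ f : k l / k + l}.
Proof. by move=> k l; apply: fpsP => m; apply: mulrDl. Qed.

HB.instance Definition _ := GRing.Zmodule_isLmodule.Build R (fps I R)
  fps_scaleA fps_scale1 fps_scaleDr fps_scaleDl.

Lemma fps_scaleAl (k : R) f g : k *: (f * g) = k *: f * g.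
Proof.
apply: fpsP => m; transitivity (k * fps_mul f g m) => //.
transitivity (fps_mul (fps_scale k f) g m) => //.
rewrite !(@mul_bigE m) ?msubset_refl// mulr_sumr; apply: eq_bigr => a _.
by rewrite mulr_sumr; apply: eq_bigr => b _; rewrite mulrnAr mulrA.
Qed.

HB.instance Definition _ :=
  GRing.Lmodule_isLalgebra.Build R (fps I R) fps_scaleAl.
HB.instance Definition _ := GRing.Lalgebra_isComAlgebra.Build R (fps I R).

End FpsRing.

(* Locked, like fps_mul. *)
HB.lock Definition fps_mon (I : choiceType) (R : comNzRingType)
    (m : {mset I}) : fps I R := fun m' => (m' == m)%:R.

Definition fps_var (I : choiceType) (R : comNzRingType) (i : I) : fps I R :=
  fps_mon R [mset i]%mset.

Section FpsSeries.
Variables (I : choiceType) (R : comNzRingType).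
Implicit Types (f g : fps I R) (m : {mset I}).

Lemma fps_coefD f g m : (f + g) m = f m + g m. Proof. by []. Qed.

Lemma fps_coefZ (k : R) f m : (k *: f) m = k * f m. Proof. by []. Qed.

Lemma fps_coefM f g m : (f * g) m =
  \sum_(p \in [set p : {mset I} * {mset I} | (p.1 `+` p.2)%mset = m])
     f p.1 * g p.2.
Proof. by transitivity (fps_mul f g m) => //; rewrite fps_mul.unlock. Qed.

Lemma fps_coef1 m : (1 : fps I R) m = (m == mset0)%:R.
Proof. by []. Qed.

Lemma fps_coef_sum (J : Type) (r : seq J) (P : pred J) (F : J -> fps I R) m :
  (\sum_(j <- r | P j) F j) m = \sum_(j <- r | P j) F j m.
Proof. by elim/big_rec2: _ => // j x y _ <-. Qed.

Lemma fps_coef_mon m m' : fps_mon R m m' = (m' == m)%:R.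
Proof. by rewrite fps_mon.unlock. Qed.

(* A family is summable when each coefficient vanishes for all but finitely
   many members; fps_sum is meaningful on summable families only (\sum_(_ \in _)
   is 0 on an infinite support). *)
Definition fps_summable (J : choiceType) (D : set J) (F : J -> fps I R) :=
  forall m, finite_set (D `&` [set j | F j m != 0]).

Definition fps_sum (J : choiceType) (D : set J) (F : J -> fps I R) : fps I R :=
  fun m => \sum_(j \in D) F j m.

Lemma fps_monM m1 m2 : fps_mon R m1 * fps_mon R m2 = fps_mon R (m1 `+` m2)%mset.
Proof.
apply: fpsP => m; rewrite fps_coefM.
case: (eqVneq m (m1 `+` m2)%mset) => [em|nem].
  rewrite (fsbigD1 (m1, m2)) //=; last exact: finite_mset_split.
  rewrite fsbig1 => [|[a b] /= [eab nab]].
    by rewrite !fps_coef_mon em !eqxx mulr1 addr0.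
  rewrite !fps_coef_mon; case: (eqVneq a m1) => [ea|]; last by rewrite mul0r.
  case: (eqVneq b m2) => [eb|]; last by rewrite mulr0.
  by case: nab; rewrite ea eb.
rewrite fsbig1 => [|[a b] /= eab]; first by rewrite !fps_coef_mon (negPf nem).
rewrite !fps_coef_mon; case: (eqVneq a m1) => [ea|]; last by rewrite mul0r.
case: (eqVneq b m2) => [eb|]; last by rewrite mulr0.
by move: nem; rewrite -eab ea eb eqxx.
Qed.

Lemma fps_mon0 : fps_mon R (mset0 : {mset I}) = 1.
Proof. by apply: fpsP => m; rewrite fps_coef_mon. Qed.

Lemma fps_varX (i : I) k : fps_var R i ^+ k = fps_mon R (msetn k i).
Proof.
elim: k => [|k IH]; first by rewrite msetn0 fps_mon0.
rewrite exprS IH fps_monM; congr (@fps_mon I R _); apply/msetP => j.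
by rewrite msetE2 !msetnE; case: eqP.
Qed.

Lemma size_msetD m1 m2 : size (m1 `+` m2)%mset = (size m1 + size m2)%N.
Proof.
rewrite -size_cat; apply: perm_size; apply/allP => x _ /=.
by rewrite count_cat !count_mem_mset msetE2.
Qed.

Lemma fps_exprS_low f k m : f mset0 = 0 -> (size m < k)%N -> (f ^+ k) m = 0.
Proof.
move=> f0; elim: k m => // k IH m; rewrite ltnS => lemk.
rewrite exprS fps_coefM fsbig1 // => -[a b] /= eab.
have [->|na] := eqVneq a mset0; first by rewrite f0 mul0r.
rewrite IH ?mulr0//; apply: leq_trans lemk.
rewrite -eab size_msetD -[X in (X < _)%N]add0n ltn_add2r lt0n.
by rewrite size_mset_eq0.
Qed.

End FpsSeries.

Definition fps_exp (I : choiceType) (K : fieldType) (f : fps I K) : fps I K :=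
  fps_sum [set: nat] (fun k => (k`!%:R : K)^-1 *: f ^+ k).

Lemma fps_exp_summable (I : choiceType) (K : fieldType) (f : fps I K) :
  f mset0 = 0 -> fps_summable [set: nat] (fun k => (k`!%:R : K)^-1 *: f ^+ k).
Proof.
move=> f0 m; apply: (@sub_finite_set _ _ `I_(size m).+1) => [k /= [_]|];
  last exact: finite_II.
by rewrite fps_coefZ ltnS leqNgt; apply: contraNN => /fps_exprS_low->;
  rewrite ?mulr0.
Qed.

Definition is_partn (n : nat) (s : seq nat) :=
  [&& sorted geq s, 0%N \notin s & sumn s == n].

(* Partitions of n, as nonincreasing sequences of positive parts. *)
Record intpartn (n : nat) := Partn { parts :> seq nat; _ : is_partn n parts }.

HB.instance Definition _ n := [isSub for @parts n].
HB.instance Definition _ n := [Countable of intpartn n by <:].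

Lemma partnP n (la : intpartn n) : is_partn n la.
Proof. by case: la. Qed.

Lemma mem_partn_le n s : is_partn n s -> all (fun i => (0 < i <= n)%N) s.
Proof.
case/and3P => _ s0 /eqP sn; apply/allP => i si; apply/andP; split.
  by rewrite lt0n; apply: contraNneq s0 => <-.
by rewrite -sn sumnE (perm_big _ (perm_to_rem si)) big_cons leq_addr.
Qed.

Lemma size_partn n s : is_partn n s -> (size s <= n)%N.
Proof.
move=> ps; have /allP s_gt0 := mem_partn_le ps.
case/and3P: ps => _ _ /eqP <-; rewrite sumnE -sum1_size.
rewrite big_seq [X in (_ <= X)%N]big_seq; apply: leq_sum => i si.
by have /andP[] := s_gt0 _ si.
Qed.

Definition partn_enum n : seq (intpartn n) :=
  undup (pmap insub
    [seq [seq i <- [seq val j | j <- val t] | i != 0%N] | t : n.-tuple 'I_n.+1]).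

Lemma partn_enumP n : Finite.axiom (partn_enum n).
Proof.
apply: Finite.uniq_enumP; first exact: undup_uniq.
move=> la; rewrite mem_undup mem_pmap_sub.
have ps := partnP la; have le_n := mem_partn_le ps.
pose s := la ++ nseq (n - size la) 0%N.
have sz : size [seq (inord i : 'I_n.+1) | i <- s] == n.
  by rewrite size_map size_cat size_nseq subnKC// size_partn.
rewrite [RHS]inE; apply/fintype.imageP; exists (Tuple sz) => //=.
have -> : [seq val j | j <- [seq (inord i : 'I_n.+1) | i <- s]] = s.
  rewrite -map_comp -[RHS]map_id; apply/eq_in_map => i.
  rewrite mem_cat /= => /orP[/(allP le_n)/andP[_ le]|/nseqP[->//]];
    by rewrite inordK.
rewrite filter_cat [X in _ ++ X](_ : _ = [::]) ?cats0; last first.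
  by apply/eqP; rewrite -[_ == _]negbK -has_filter; apply/hasPn => i /nseqP[->].
by apply/esym/all_filterP/allP => i /(allP le_n); rewrite lt0n => /andP[].
Qed.

HB.instance Definition _ n := isFinite.Build (intpartn n) (@partn_enumP n).

Definition part_mult n (la : intpartn n) (i : nat) : nat := count_mem i la.

Definition has_cycle_type n (x : 'S_n) (la : intpartn n) :=
  perm_eq [seq #|c| | c : {set 'I_n} in porbits x] la.

(* The default 1 is never reached: see perm_of_partnP below. *)
Definition perm_of_partn n (la : intpartn n) : 'S_n :=
  odflt 1%g [pick x : 'S_n | has_cycle_type x la].

(* zeta i is a chosen primitive i-th root of unity, for each i > 0. *)
Record prim_roots := PrimRoots {
  zeta_ :> nat -> algC;
  prim_rootsP : forall i, (0 < i)%N -> i.-primitive_root (zeta_ i) }.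

Lemma prim_roots_inhabited : inhabited prim_roots.
Proof.
have P i : exists z : algC, (0 < i)%N -> i.-primitive_root z.
  case: i => [|i]; first by exists 0.
  by have [z ?] := C_prim_root_exists (ltn0Sn i); exists z.
have [z zP] := choice P; exact: (inhabits (PrimRoots zP)).
Qed.

Section Omega.
Variables (zeta : prim_roots) (n : nat) (x : 'S_n).
Implicit Types (p q : 'I_n) (y z : 'S_n).

(* Label the points of the r-th cycle of x by (r, t), with x (r, t) = (r, t + 1)
   and p_r = froot x p_r as (r, 0). For z centralizing x, z p_r = (sigma r, k_r)
   with k_r = findex x (froot x (z p_r)) (z p_r), the number of applications of
   x leading from the root of the cycle of z p_r to z p_r. Taken over the roots
   of all cycles of x, the product below is that of the zeta_i ^ k_r. *)
Definition omega_fun (z : 'S_n) : algC :=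
  \prod_(p : 'I_n | froots x p)
     zeta #|porbit x p| ^+ findex x (froot x (z p)) (z p).

Lemma perm_iter y k p : iter k y p = (y ^+ k)%g p.
Proof. by rewrite permX. Qed.

Lemma fconnect_porbit p q : fconnect x p q = (q \in porbit x p).
Proof.
apply/idP/porbitP => [/iter_findex <-|[k ->]].
  by exists (findex x p q); rewrite permX.
by rewrite permX fconnect_iter.
Qed.

Let sym : fingraph.connect_sym (frel x).
Proof. exact: (fconnect_sym perm_inj). Qed.

Lemma cent_iter z k p : z \in 'C[x]%g -> z (iter k x p) = iter k x (z p).
Proof.
move=> /cent1P zx; elim: k => //= k <-.
by rewrite -!permM zx.
Qed.

Lemma cent_connect z p q : z \in 'C[x]%g ->
  fconnect x p q -> fconnect x (z p) (z q).
Proof. by move=> zx /iter_findex <-; rewrite cent_iter// fconnect_iter. Qed.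

Lemma order_porbit p : fingraph.order x p = #|porbit x p|.
Proof. by apply: eq_card => q; rewrite -fconnect_porbit. Qed.

Lemma cent_froot z p : z \in 'C[x]%g ->
  froot x (z (froot x p)) = froot x (z p).
Proof.
move=> zx; apply/eqP; rewrite root_connect//.
by apply: cent_connect => //; rewrite sym connect_root.
Qed.

Lemma card_porbit_cent z p : z \in 'C[x]%g -> #|porbit x (z p)| = #|porbit x p|.
Proof.
move=> zx; suff -> : porbit x (z p) = [set z q | q in porbit x p]%SET.
  by rewrite card_imset//; apply: perm_inj.
apply/setP => q; apply/idP/imsetP => [/porbitP[k ->]|[r /porbitP[k ->] ->]].
  exists ((x ^+ k)%g p); first exact: mem_porbit.
  by rewrite !permX cent_iter.
by rewrite permX cent_iter// -permX mem_porbit.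
Qed.

Lemma zeta_order p : zeta #|porbit x p| ^+ #|porbit x p| = 1.
Proof.
apply: prim_expr_order; apply: prim_rootsP.
by rewrite -order_porbit fingraph.order_gt0.
Qed.

Lemma zeta_findex p q k : fconnect x p q ->
  zeta #|porbit x p| ^+ findex x p (iter k x q)
  = zeta #|porbit x p| ^+ (findex x p q + k).
Proof.
move=> pq; elim: k => [|k IH]; first by rewrite addn0.
rewrite addnS exprSr -IH /= -exprSr.
set r := iter k x q.
have pr : fconnect x p r by apply: connect_trans pq _; apply: fconnect_iter.
have lt := findex_max pr.
have [lt2|] := ltnP (findex x p r).+1 (fingraph.order x p).
  by congr (_ ^+ _); rewrite -[in LHS](iter_findex pr) -iterS findex_iter.
rewrite leq_eqVlt ltnNge lt orbF => /eqP e.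
rewrite -e order_porbit zeta_order.
rewrite -[in LHS](iter_findex pr) -iterS -e (iter_order perm_inj).
by rewrite findex0.
Qed.

Lemma omega_funM y z : y \in 'C[x]%g -> z \in 'C[x]%g ->
  omega_fun (y * z)%g = omega_fun y * omega_fun z.
Proof.
move=> yx zx.
pose h p := froot x (y p).
have omz : omega_fun z = \prod_(p : 'I_n | froots x p)
    zeta #|porbit x p| ^+ findex x (froot x (z (h p))) (z (h p)).
  rewrite /omega_fun (reindex_onto h (fun q => froot x ((y^-1)%g q))) /=.
    apply: eq_big => [p|p _].
      rewrite /h /fingraph.roots/= root_root// eqxx /= cent_froot ?groupV// permK.
      by rewrite /fingraph.roots.
    congr (zeta _ ^+ _); rewrite -(card_porbit_cent p yx) /h.
    apply/eq_card => q; rewrite -!fconnect_porbit.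
    by rewrite -(same_connect sym (connect_root _ _)).
  move=> p; rewrite /fingraph.roots /h => /eqP rp.
  by rewrite cent_froot// permKV.
rewrite omz -big_split /=; apply: eq_bigr => p _.
rewrite -exprD permM.
have hp : fconnect x (h p) (y p) by rewrite sym connect_root.
rewrite -[in z (y p)](iter_findex hp) cent_iter//.
rewrite addnC; set k := findex x (h p) (y p).
have -> : froot x (iter k x (z (h p))) = froot x (z (h p)).
  by apply/eqP; rewrite root_connect// sym fconnect_iter.
have hz : fconnect x (froot x (z (h p))) (z (h p)) by rewrite sym connect_root.
have <- : #|porbit x (froot x (z (h p)))| = #|porbit x p|.
  rewrite -(card_porbit_cent p yx) -(card_porbit_cent (y p) zx) -!order_porbit.
  apply/eq_card => q; apply: same_connect => //.
  by apply: (connect_trans hz); apply: cent_connect.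
by rewrite zeta_findex.
Qed.

Lemma omega_fun1 : omega_fun 1%g = 1.
Proof.
rewrite /omega_fun big1 // => p /eqP rp.
by rewrite perm1 rp findex0 expr0.
Qed.

Lemma omega_is_class_fun :
  is_class_fun <<'C[x]>>%g
    [ffun z => omega_fun z *+ (z \in 'C[x]%g)].
Proof.
rewrite genGid; apply: intro_class_fun => [y z yx zx|y /negPf->] //.
rewrite groupJ// yx conjgE !omega_funM ?groupM ?groupV// mulrC -mulrA.
by rewrite -omega_funM ?groupV// mulgV omega_fun1 mulr1.
Qed.

Definition omega : 'CF('C[x]%g) := Cfun 0 omega_is_class_fun.

Lemma omegaE z : z \in 'C[x]%g -> omega z = omega_fun z.
Proof. by move=> zx; rewrite cfunE zx. Qed.

Lemma omega_lin_char : omega \is a linear_char.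
Proof.
have rP : mx_repr 'C[x]%g (fun z => (omega z)%:M : 'M[algC]_1).
  split=> [|y z yx zx].
    by rewrite omegaE ?group1// omega_fun1.
  by rewrite -scalar_mxM !omegaE ?groupM// omega_funM.
have -> : omega = cfRepr (MxRepresentation rP).
  apply/cfun_inP => z zx; rewrite [RHS]cfunE zx /=.
  by rewrite mulr1n /mxtrace big_ord1 mxE eqxx mulr1n.
by rewrite qualifE /= cfRepr_char cfRepr1 eqxx.
Qed.

End Omega.

Definition higher_lie (zeta : prim_roots) n (la : intpartn n)
  : 'CF([set: 'S_n]%SET) :=
  'Ind[[set: 'S_n]%SET] (omega zeta (perm_of_partn la)).

Section CycleTypeExists.
Variables (n : nat) (la : intpartn n).

Let k := size la.
Let T := {i : 'I_k & 'I_(nth 0%N la i)}.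

Let cardT : #|{: T}| = n.
Proof.
rewrite card_tagged sumnE big_map big_enum /=.
have /and3P[_ _ /eqP ln] := partnP la; rewrite -[RHS]ln sumnE (big_nth 0%N).
by rewrite big_mkord; apply: eq_bigr => i _; rewrite card_ord.
Qed.

Let g (p : 'I_n) : T := enum_val (cast_ord (esym cardT) p).
Let h (u : T) : 'I_n := cast_ord cardT (enum_rank u).
Let gK : cancel g h.
Proof. by move=> p; rewrite /g /h enum_valK cast_ordKV. Qed.
Let hK : cancel h g.
Proof. by move=> u; rewrite /g /h cast_ordK enum_rankK. Qed.

Let rot1 (u : T) : T := Tagged (fun i : 'I_k => 'I_(nth 0%N la i)) (ordS (tagged u)).

Let rot1_inj : injective rot1.
Proof.
move=> [i a] [j b] /= e; have eij : i = j by case/(congr1 tag): e.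
move: b e; rewrite -{}eij => b /eqP; rewrite eq_Tagged /= => /eqP.
by move/(can_inj (@ordSK _)) ->.
Qed.

Let iter_rot1 m (i : 'I_k) (a : 'I_(nth 0%N la i)) :
  iter m rot1 (Tagged (fun i : 'I_k => 'I_(nth 0%N la i)) a)
  = Tagged (fun i : 'I_k => 'I_(nth 0%N la i)) (iter m (@ordS _) a).
Proof. by elim: m => //= m ->. Qed.

Let iter_ordS m N (a : 'I_N) : iter m (@ordS N) a = ((a + m) %% N)%N :> nat.
Proof.
elim: m => [|m IH] /=; first by rewrite addn0 modn_small.
by rewrite IH -addn1 modnDml addn1 addnS.
Qed.

Let f p := h (rot1 (g p)).
Let f_inj : injective f.
Proof. by move=> p q /(can_inj hK)/rot1_inj/(can_inj gK). Qed.
Let x : 'S_n := perm f_inj.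

Let g_iter m p : g ((x ^+ m)%g p) = iter m rot1 (g p).
Proof.
elim: m => [|m IH]; first by rewrite perm1.
by rewrite expgSr permM permE hK IH.
Qed.

Let porbit_x p : porbit x p = [set q | tag (g q) == tag (g p)]%SET.
Proof.
apply/setP => q; rewrite inE; apply/porbitP/eqP => [[m ->]|].
  by rewrite g_iter; case: (g p) => i a; rewrite iter_rot1.
case Eq : (g q) => [j b]; case Ep : (g p) => [i a] /= eji.
move: b Eq; rewrite {}eji => b Eq.
exists (b + (nth 0%N la i - a))%N; apply: (can_inj gK).
rewrite g_iter Eq Ep iter_rot1; congr (Tagged _ _); apply: val_inj => /=.
by rewrite iter_ordS addnCA subnKC ?modnDr ?modn_small// ltnW.
Qed.

Let F (i : 'I_k) := [set q | tag (g q) == i]%SET.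

Let card_F i : #|F i| = nth 0%N la i.
Proof.
rewrite -[RHS]card_ord.
have -> : F i = [set h (Tagged (fun i : 'I_k => 'I_(nth 0%N la i)) a)
               | a : 'I_(nth 0%N la i)]%SET.
  apply/setP => q; rewrite inE; apply/eqP/imsetP => [|[a _ ->]]; last by rewrite hK.
  case E : (g q) => [j b] /= eji; move: b E; rewrite {}eji => b E.
  by exists b => //; rewrite -[LHS]gK E.
rewrite card_imset// => a b /(can_inj hK)/eqP; rewrite eq_Tagged /=.
by move/eqP.
Qed.

Let nth_gt0 (i : 'I_k) : (0 < nth 0%N la i)%N.
Proof.
have /allP h0 := mem_partn_le (partnP la).
by have /andP[] := h0 _ (mem_nth 0%N (ltn_ord i)).
Qed.

Let F_inj : injective F.
Proof.
move=> i j eF; have : (0 < #|F i|)%N by rewrite card_F.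
case/card_gt0P => q qi; move: (qi); rewrite eF.
by move: qi; rewrite !inE => /eqP-> /eqP.
Qed.

Lemma cycle_type_exists : exists y : 'S_n, has_cycle_type y la.
Proof.
exists x; rewrite /has_cycle_type.
have /(perm_map (fun c : {set 'I_n} => #|c|)) :
  perm_eq (enum (porbits x)) [seq F i | i <- enum 'I_k].
  apply: uniq_perm; first exact: enum_uniq.
    by rewrite map_inj_uniq ?enum_uniq.
  move=> c; rewrite mem_enum; apply/imsetP/mapP => [[p _ ->]|[i _ ->]].
    by exists (tag (g p)); rewrite ?mem_enum // porbit_x.
  have /card_gt0P[q] : (0 < #|F i|)%N by rewrite card_F.
  by rewrite inE => /eqP qi; exists q => //; rewrite porbit_x qi.
rewrite -map_comp => /perm_trans; apply.
rewrite (_ : [seq _ | i <- _] = la)//.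
transitivity [seq nth 0%N la i | i <- map val (enum 'I_k)].
  by rewrite -map_comp; apply/eq_in_map => i _; apply: card_F.
by rewrite val_enum_ord -[RHS](mkseq_nth 0%N).
Qed.

Lemma perm_of_partnP : has_cycle_type (perm_of_partn la) la.
Proof.
rewrite /perm_of_partn; case: pickP => //= h0.
by have [y] := cycle_type_exists; rewrite h0.
Qed.

End CycleTypeExists.

Definition mobius (n : nat) : int :=
  if all (fun p => logn p n == 1%N) (primes n) then (-1) ^+ size (primes n)
  else 0.

Definition zcard n (nu : intpartn n) : nat :=
  \prod_(1 <= j < n.+1) ((part_mult nu j)`! * j ^ part_mult nu j)%N.

Definition sign_partn n (nu : intpartn n) : algC := (-1) ^+ perm_of_partn nu.

(* The ring C[[s, t]], over the algebraic numbers algC, in which all the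
   coefficients at hand lie: inl i is the index of s_i and inr j that of t_j; the
   indeterminates s_0 and t_0 never occur. *)
Notation fps_st := (fps (nat + nat)%type algC).

Definition s_ (i : nat) : fps_st := fps_var algC (inl i).
Definition t_ (j : nat) : fps_st := fps_var algC (inr j).

Definition s_mon n (la : intpartn n) : fps_st :=
  \prod_(1 <= i < n.+1) s_ i ^+ part_mult la i.
Definition t_mon n (nu : intpartn n) : fps_st :=
  \prod_(1 <= j < n.+1) t_ j ^+ part_mult nu j.

Section Summability.

(* The infinite sums of the generating function identity are summable, so
   fps_sum never takes its default value there: see log_inner_summable,
   log_outer_summable and cycle_index_summable, and, for the exponential,
   log_coef0 with fps_exp_summable. *)
Definition log_term (i j : nat) : fps_st :=
  \sum_(e <- divisors (gcdn i j))
     ((-1) ^+ (i %/ e * j.-1) * (mobius e)%:~R / (i * j %/ e)%:R)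
       *: (s_ i ^+ (j %/ e) * t_ j ^+ (i %/ e)).

Lemma log_term_supp i j (m : {mset nat + nat}) : (0 < i)%N -> (0 < j)%N ->
  log_term i j m != 0 -> (inl i \in m) && (inr j \in m).
Proof.
move=> i0 j0; apply: contraNT => nm.
rewrite /log_term fps_coef_sum big_seq big1 // => e.
rewrite -dvdn_divisors ?gcdn_gt0 ?i0// dvdn_gcd => /andP[ei ej].
have d_gt0 k : (0 < k)%N -> (e %| k)%N -> (0 < k %/ e)%N.
  by move=> k0 ek; rewrite divn_gt0 ?(dvdn_gt0 k0)// dvdn_leq.
rewrite fps_coefZ /s_ /t_ !fps_varX fps_monM fps_coef_mon.
case: eqP => [em|_]; last by rewrite mulr0.
by case/negP: nm; rewrite em !in_msetD !in_msetn !d_gt0// !eqxx ?orbT.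
Qed.

Let finite_mem (J : choiceType) (f : J -> (nat + nat)%type) (m : {mset nat + nat}) :
  injective f -> finite_set [set j | f j \in m].
Proof.
move=> f_inj; pose A := [set x : nat + nat | x \in finsupp m].
apply: (@sub_finite_set _ _ (f @^-1` A)) => [j /= jm|].
  by rewrite /A /= msuppE.
by apply: finite_preimage => [? ? _ _ /f_inj//|]; apply: finite_fset.
Qed.

Lemma log_inner_summable i : (0 < i)%N ->
  fps_summable [set j | (0 < j)%N] (log_term i).
Proof.
move=> i0 m; apply: (sub_finite_set _ (@finite_mem _ inr m _)) => [j [/= j0]|].
  by case/(log_term_supp i0 j0)/andP.
by move=> ? ? [].
Qed.

Lemma log_outer_summable :
  fps_summable [set i | (0 < i)%N]
    (fun i => fps_sum [set j | (0 < j)%N] (log_term i)).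
Proof.
move=> m; apply: (sub_finite_set _ (@finite_mem _ inl m _)) => [i [/= i0]|].
  move/(@fsbigN1 _ _ _ _ _ _ (fun i j => log_term i j m)) => [j j0].
  by case/(log_term_supp i0 j0)/andP.
by move=> ? ? [].
Qed.

Lemma log_coef0 :
  fps_sum [set i | (0 < i)%N]
    (fun i => fps_sum [set j | (0 < j)%N] (log_term i)) mset0 = 0.
Proof.
rewrite [LHS]fsbig1 // => i i0; rewrite [LHS]fsbig1 // => j j0.
apply/eqP; apply/negP => /negP /(log_term_supp i0 j0).
by rewrite in_mset0.
Qed.

Let wt (m : {mset nat + nat}) : nat :=
  \sum_(x <- (m : seq _)) (if x is inl i then i else 0)%N.

Let wtD m1 m2 : wt (m1 `+` m2)%mset = (wt m1 + wt m2)%N.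
Proof.
rewrite /wt -big_cat; apply: perm_big; apply/allP => x _ /=.
by rewrite count_cat !count_mem_mset msetE2.
Qed.

Let wtn k x : wt (msetn k x) = (k * if x is inl i then i else 0)%N.
Proof. by rewrite /wt enum_msetn big_nseq iter_addn_0 mulnC. Qed.

Let prod_mon n (a : nat -> nat) (f : nat -> nat + nat) :
  exists2 m, \prod_(1 <= i < n.+1) fps_var algC (f i) ^+ a i = fps_mon algC m
    & wt m = (\sum_(1 <= i < n.+1) a i * if f i is inl k then k else 0)%N.
Proof.
elim: n => [|n [m em wm]].
  exists mset0; first by rewrite big_nil fps_mon0.
  by rewrite /wt enum_mset0 !big_nil.
exists (m `+` msetn (a n.+1) (f n.+1))%mset; rewrite big_nat_recr//=.
  by rewrite em fps_varX fps_monM.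
by rewrite wtD wtn wm.
Qed.

Let sum_mult n (la : intpartn n) : (\sum_(1 <= i < n.+1) part_mult la i * i)%N = n.
Proof.
have /and3P[_ _ /eqP ln] := partnP la; rewrite -[RHS]ln.
rewrite /part_mult; have := mem_partn_le (partnP la).
elim: (la : seq nat) => [_|k s IH /= /andP[kn /IH <-]]; first by rewrite big1.
under eq_bigr do rewrite mulnDl.
rewrite big_split /=; congr (_ + _)%N.
rewrite (bigD1_seq k) ?iota_uniq ?mem_index_iota//= eqxx mul1n big1 ?addn0//.
by move=> i ik; rewrite eq_sym (negPf ik).
Qed.

Lemma cycle_index_summable (c : forall n, intpartn n -> intpartn n -> algC) :
  fps_summable [set: nat] (fun n => \sum_(la : intpartn n) \sum_(nu : intpartn n)
    c n la nu *: (s_mon la * t_mon nu)).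
Proof.
move=> m; apply: (sub_finite_set _ (finite_set1 (wt m))) => n [_ /=].
apply: contraNP => nm; rewrite fps_coef_sum big1 // => la _.
rewrite fps_coef_sum big1 // => nu _; rewrite fps_coefZ.
have [m1 e1 w1] := prod_mon n (part_mult la) inl.
have [m2 e2 w2] := prod_mon n (part_mult nu) inr.
rewrite /s_mon /t_mon e1 e2 fps_monM fps_coef_mon; case: eqP => [em|_]; last first.
  by rewrite mulr0.
case: nm; rewrite em wtD w1 w2 sum_mult big1 ?addn0// => i _.
by rewrite muln0.
Qed.

End Summability.

(* Main.v *)
(* Expanding the induced characters, n! times the n-th term of the left-hand side is
   the sum, over the commuting pairs (x, y) in S_n, of a weight that is multiplicative
   over the orbits of the group generated by x and y. An orbit with a chosen base
   point is a quotient of Z x Z, given by the length i of the cycle of x at the base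
   point, the number a of cycles of x, and k < i such that y ^ a acts as x ^ k; its
   weight is zeta_i ^ k s_i ^ a t'_(a i / d) ^ d, where d = gcd(i, k) and
   t'_j = (-1) ^ (j - 1) t_j. Removing the orbit of a point yields
     n p_n = sum_(i, a) g(i, a) p_(n - i a)
   for the n-th term p_n, where g(i, a) sums the weights over k. As the sum of the
   primitive e-th roots of unity is mu(e),
     g(i, a) = sum_(e | i) mu(e) s_i ^ a t'_(a e) ^ (i / e),
   so both sides of the identity satisfy D F = K F with the same K, D being the
   derivation that multiplies a monomial by its weight, and this determines F. The
   size n! / z_nu of a conjugacy class comes from the same recursion, specialized to
   s_1 = 1 and s_i = 0 for i > 1. *)

Require Import Defs.
From mathcomp Require Import all_boot all_order all_algebra all_fingroup.
From mathcomp Require Import all_solvable all_field all_character.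
From mathcomp Require Import finmap multiset.
From mathcomp Require Import boolp classical_sets functions cardinality fsbigop.
From mathcomp Require Import zify ring.

Set Implicit Arguments.
Unset Strict Implicit.
Unset Printing Implicit Defensive.

Import Order.TTheory GRing.Theory Num.Theory.
Local Open Scope ring_scope.

(** Orbits are not handled as sets but through equivariant injections of a standard grid. Such an
    injection amounts to a base point, so a pair on [A] has exactly [#|A|] of them over all grid
    shapes; this is the factor n. For a fixed injection, the pairs that make it equivariant are a
    translate of the commuting pairs on the complement of its image, and the injections are counted
    by a falling factorial, which the division by n! absorbs. Supports are confined to a subset [A]
    so that deleting an orbit stays in the same symmetric group. The coefficient of the character at
    one cycle depends on the chosen roots. A phase along the cycles of x turns these coefficients
    into ratios, which telescope over an orbit. The equations D F = K F are proved on finite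
    truncations, one monomial at a time, and the uniqueness argument lets K vary with the monomial.
    The weight counts s and t alike, so that only the monomial 1 has weight 0; hence p_n has weight
    2n, and K carries a factor 2 on both sides. *)

Lemma iter_ordS n m (r : 'I_n) : iter m (@ordS n) r = ((r + m) %% n)%N :> nat.
Proof.
elim: m => [|m IH] /=; first by rewrite addn0 modn_small.
by rewrite IH -addn1 modnDml addn1 addnS.
Qed.

Lemma iterC (T : Type) (f g : T -> T) m p :
  (forall q, f (g q) = g (f q)) -> iter m f (g p) = g (iter m f p).
Proof. by move=> fg; elim: m => //= m ->. Qed.

(** * Commuting pairs of permutations *)

(* The standard transitive action of Z x Z on a.+1 cycles of length i.+1: the first
   generator rotates each cycle, the second one moves from each cycle to the next
   and its power a.+1 acts as the k-th power of the first. *)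
Section Grid.
Variables (i a : nat).
Local Notation U := ('I_a.+1 * 'I_i.+1)%type.

Definition grid_x (u : U) : U := (u.1, ordS u.2).
Definition grid_y (k : nat) (u : U) : U :=
  (ordS u.1, iter (if u.1 == ord_max then k else 0%N) (@ordS _) u.2).

Lemma grid_x_inj : injective grid_x.
Proof. by move=> [r u] [r' u'] /pair_equal_spec[/= -> /ordS_inj ->]. Qed.

Lemma grid_y_inj k : injective (grid_y k).
Proof.
move=> [r u] [r' u']; rewrite /grid_y => /pair_equal_spec[/= /ordS_inj <-].
elim: (if _ then _ else _) => [/= ->//|m IH /= /ordS_inj/IH //].
Qed.

Lemma grid_xyC k u : grid_x (grid_y k u) = grid_y k (grid_x u).
Proof. by congr (_, _) => /=; rewrite -iterS iterSr. Qed.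

End Grid.

Lemma iter_porbit_inj n (x : 'S_n) m l b :
  (m < #|porbit x b|)%N -> (l < #|porbit x b|)%N ->
  iter m x b = iter l x b -> m = l.
Proof.
move=> lm ll e; apply/eqP.
have := nth_uniq b _ _ (uniq_traject_porbit x b).
move/(_ m l); rewrite size_traject => /(_ lm ll).
by rewrite !nth_traject // e eqxx.
Qed.

Section BasePoint.
Variables (n : nat) (x y : 'S_n).
Hypothesis xy : (x * y = y * x)%g.

Let xyq q : x (y q) = y (x q).
Proof. by rewrite -!permM xy. Qed.

Let xyi m l q : iter m x (iter l y q) = iter l y (iter m x q).
Proof. by rewrite iterC // => q'; rewrite -iterC. Qed.

Definition grid_map (i a : nat) (b : 'I_n) (u : 'I_a.+1 * 'I_i.+1) : 'I_n :=
  iter u.2 x (iter u.1 y b).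

(** This says that the orbit of [b] is a copy of the standard grid with [b] at its corner;
    [grid_map] is the only candidate for such a copy. *)
Definition grid_based (i a k : nat) (b : 'I_n) : bool :=
  [&& injectiveb (@grid_map i a b), iter i.+1 x b == b
    & iter a.+1 y b == iter k x b].

Definition grid_equiv (i a k : nat) (f : 'I_a.+1 * 'I_i.+1 -> 'I_n) : bool :=
  [forall u, (x (f u) == f (grid_x u)) && (y (f u) == f (grid_y k u))].

Lemma grid_equivP i a k (f : 'I_a.+1 * 'I_i.+1 -> 'I_n) :
  reflect ((forall u, x (f u) = f (grid_x u)) /\
           (forall u, y (f u) = f (grid_y k u)))
    (grid_equiv k f).
Proof.
apply: (iffP forallP) => [h|[hx hy] u]; last by rewrite hx hy !eqxx.
by split=> u; have /andP[/eqP ? /eqP ?] := h u.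
Qed.

Lemma iter_mod_period m p q (z : 'S_p) (b : 'I_p) :
  iter q z b = b -> iter (m %% q) z b = iter m z b.
Proof.
move=> zb; rewrite [in RHS](divn_eq m q) addnC iterD; congr (iter _ _ _).
by elim: (m %/ q)%N => //= d IH; rewrite mulSn iterD -IH zb.
Qed.

(** The grid wraps around in two ways, at the end of a cycle and after the last cycle. The
    hypotheses settle both at [b], and commutation carries them to the other points. *)
Lemma grid_map_equiv i a k b : iter i.+1 x b = b -> iter a.+1 y b = iter k x b ->
  grid_equiv k (@grid_map i a b).
Proof.
move=> xb yb; apply/grid_equivP; split=> [[r t]|[r t]]; rewrite /grid_map /=.
  rewrite -iterS; apply/esym; rewrite iter_mod_period //.
  by rewrite xyi xb.
rewrite -iterC //; rewrite -[y (iter _ _ _)]iterS.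
have [->|nr] := eqVneq r ord_max => /=.
  by move: yb => /= ->; rewrite modnn /= iter_ordS iter_mod_period // iterD.
rewrite modn_small // ltnS ltn_neqAle -ltnS ltn_ord andbT.
by apply: contraNneq nr => e; apply/eqP/val_inj.
Qed.

(** Each cell is reached from the corner by steps of [grid_y] and then of [grid_x] that do not wrap
    around, so the value at the corner determines [f]. The two wrap-arounds yield the relations. *)
Lemma grid_equiv_map i a k (f : 'I_a.+1 * 'I_i.+1 -> 'I_n) :
  grid_equiv k f ->
  [/\ f =1 @grid_map i a (f (ord0, ord0)),
      iter i.+1 x (f (ord0, ord0)) = f (ord0, ord0)
    & iter a.+1 y (f (ord0, ord0)) = iter k x (f (ord0, ord0))].
Proof.
case/grid_equivP=> fx fy; set b := f _.
have fxi m u : iter m x (f u) = f (u.1, iter m (@ordS _) u.2).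
  by elim: m => [|m /= ->]; [case: u | rewrite fx].
have fyi m : (m <= a)%N -> iter m y b = f (inord m, ord0).
  elim: m => [|m IH] le.
    by congr f; congr (_, _); apply/val_inj; rewrite /= inordK.
  rewrite iterS IH ?(ltnW le)// fy /grid_y /=; congr (f (_, _)).
    by apply: val_inj; rewrite /= !inordK ?modn_small // ltnW.
  rewrite ifN // -val_eqE /= inordK; last by apply: ltnW.
  by rewrite ltn_eqF.
split=> [[r t]||].
- rewrite /grid_map /= fyi; last by rewrite -ltnS.
  rewrite fxi /=; congr (f (_, _)); first by rewrite inord_val.
  by apply: val_inj; rewrite /= iter_ordS add0n modn_small.
- rewrite fxi; congr (f (_, _)); apply: val_inj.
  by rewrite [LHS]iter_ordS add0n modnn.
- rewrite iterS fyi // fy fxi; congr (f (_, _)) => /=.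
    by apply: val_inj; rewrite /= inordK // modnn.
  by rewrite ifT // -val_eqE /= inordK.
Qed.


Let porbit_iter b q : q \in porbit x b ->
  exists2 m, (m < #|porbit x b|)%N & q = iter m x b.
Proof. by rewrite porbit_traject => /trajectP. Qed.

(** Here [i0.+1] is the length of the cycle of [x] at [b], [a0.+1] the least positive power of [y]
    that brings [b] back to this cycle, and [k0] the place of arrival. A smaller grid does not close
    up, a larger one meets a point twice. *)
Lemma grid_based_unique b : exists i0 a0 k0, (k0 <= i0)%N /\
  forall i a k, (k <= i)%N ->
    grid_based i a k b = [&& i == i0, a == a0 & k == k0].
Proof.
have ex_a : exists a, iter a.+1 y b \in porbit x b.
  exists #|porbit y b|.-1; rewrite prednK ?iter_porbit ?porbit_id//.
  by rewrite lt0n card_porbit_neq0.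
case: (ex_minnP ex_a) => a0 ya0 min_a.
have [k0 lek0 yk0] := porbit_iter ya0.
have o_gt0 : (0 < #|porbit x b|)%N by rewrite lt0n card_porbit_neq0.
exists #|porbit x b|.-1, a0, k0; split; first by rewrite -ltnS prednK.
move=> i a k lek; apply/idP/idP.
  case/and3P=> /injectiveP inj /eqP xb /eqP yb.
  have ei : i = #|porbit x b|.-1.
    have [lt|lt|//] := ltngtP i #|porbit x b|.-1.
      have lt1 : (i.+1 < #|porbit x b|)%N by rewrite -ltn_predRL.
      by have := iter_porbit_inj lt1 o_gt0 xb.
    have lt' : (#|porbit x b| < i.+1)%N by rewrite ltnS -(prednK o_gt0).
    have := inj (ord0, ord0) (ord0, Ordinal lt').
    rewrite /grid_map /= iter_porbit => /(_ erefl) [] e.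
    by move: o_gt0; rewrite -e.
  have ltk : (k < #|porbit x b|)%N by rewrite -(prednK o_gt0) -ei.
  have ea : a = a0.
    apply/eqP; rewrite eqn_leq min_a ?andbT; last first.
      by rewrite yb -permX mem_porbit.
    rewrite leqNgt; apply/negP => lt.
    have lt1 : (a0.+1 < a.+1)%N by [].
    have lt2 : (k0 < i.+1)%N by rewrite ei prednK.
    have := inj (Ordinal lt1, ord0) (ord0, Ordinal lt2).
    by rewrite /grid_map /= -yk0 => /(_ erefl).
  rewrite ei ea !eqxx /=; apply/eqP/(@iter_porbit_inj _ x _ _ b) => //.
  by rewrite -yk0 -yb ea.
case/and3P=> /eqP ei /eqP ea /eqP ek; rewrite /grid_based ei ea ek -yk0 eqxx andbT.
have -> : iter #|porbit x b|.-1.+1 x b = b by rewrite prednK // iter_porbit.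
rewrite eqxx andbT.
apply/injectiveP; suff H (r r' : 'I_a0.+1) (t t' : 'I_(#|porbit x b|.-1.+1)) :
    (r <= r')%N -> @grid_map _ _ b (r, t) = @grid_map _ _ b (r', t') ->
    (r, t) = (r', t').
  move=> [r t] [r' t'] e; have [le|/ltnW le] := leqP r r'; first exact: H.
  by apply/esym/H.
have lt_o (u : 'I_(#|porbit x b|.-1.+1)) : (u < #|porbit x b|)%N.
  by rewrite -[X in (_ < X)%N](prednK o_gt0) ltn_ord.
rewrite /grid_map /= => le e.
(* If [r < r'], cancelling the [r]-th power of [y] puts [iter (r' - r) y b] on the cycle of [b],
   against the minimality of [a0]. *)
have err' : r = r'.
  apply: val_inj => /=; apply/eqP; rewrite eqn_leq le leqNgt; apply/negP => lt.
  have e2 : iter t x b = iter t' x (iter (r' - r) y b).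
    apply: (@perm_inj _ (y ^+ r)%g); rewrite !permX -!xyi e; congr (iter _ _ _).
    by rewrite -iterD subnKC // ltnW.
  have yb : iter (r' - r) y b \in porbit x b.
    have := mem_porbit x t' (iter (r' - r) y b).
    rewrite permX -e2 -eq_porbit_mem => /eqP; rewrite -permX porbit_perm => ->.
    exact: porbit_id.
  have := min_a (r' - r).-1; rewrite prednK ?subn_gt0 // => /(_ yb).
  by have := ltn_ord r'; lia.
congr (_, _) => //; move: e; rewrite err' xyi (xyi t').
rewrite -!permX; move/perm_inj; rewrite !permX => e.
exact/val_inj/(iter_porbit_inj (lt_o t) (lt_o t') e).
Qed.

End BasePoint.

Section CommutingPairs.
Variable n : nat.
Implicit Types (x y : 'S_n) (z : 'S_n * 'S_n) (A B : {set 'I_n}).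

Definition comm_pair A z :=
  [&& perm_on A z.1, perm_on A z.2 & (z.1 * z.2 == z.2 * z.1)%g].

Definition grid_in i a A (f : {ffun 'I_a.+1 * 'I_i.+1 -> 'I_n}) :=
  injectiveb f && [forall u, f u \in A].

Lemma perm_on_iter A x m b : perm_on A x -> (iter m x b \in A) = (b \in A).
Proof. by move=> xA; elim: m => //= m <-; rewrite perm_closed. Qed.

(** Evaluation at the corner is a bijection from equivariant injections to base points, with inverse
    [grid_map]. *)
Lemma card_grid A z i a k : comm_pair A z ->
  #|[pred f : {ffun 'I_a.+1 * 'I_i.+1 -> 'I_n} |
       grid_in A f & grid_equiv z.1 z.2 k f]|
  = #|[pred b in A | grid_based z.1 z.2 i a k b]|.
Proof.
case: z => x y /and3P[/= xA yA /eqP xy].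
pose F b : {ffun 'I_a.+1 * 'I_i.+1 -> 'I_n} := [ffun u => grid_map x y b u].
have F0 b : F b (ord0, ord0) = b by rewrite ffunE.
rewrite -[RHS](@card_in_imset _ _ F); last first.
  by move=> b b' _ _ e; rewrite -(F0 b) e F0.
apply: eq_card => f; rewrite !inE; apply/andP/imsetP.
  case=> /andP[/injectiveP inj /forallP fA] /grid_equiv_map[ef fx fy].
  exists (f (ord0, ord0)); last by apply/ffunP => u; rewrite ffunE ef.
  rewrite !inE fA /grid_based fx fy !eqxx !andbT; apply/injectiveP => u v.
  by rewrite -!ef => /inj.
case=> b; rewrite !inE => /andP[bA /and3P[/injectiveP inj /eqP bx /eqP yb]] ->.
split; last first.
  have /grid_equivP[h1 h2] := grid_map_equiv xy bx yb.
  by apply/grid_equivP; split=> u; rewrite !ffunE.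
apply/andP; split; first by apply/injectiveP => u v; rewrite !ffunE => /inj.
by apply/forallP => u; rewrite ffunE /grid_map !perm_on_iter.
Qed.

(** Each point of [A] is the corner of exactly one grid, by [grid_based_unique]. *)
Lemma sum_card_grid A z : comm_pair A z ->
  (\sum_(i < #|A|) \sum_(a < #|A|) \sum_(k < i.+1)
    #|[pred f : {ffun 'I_a.+1 * 'I_i.+1 -> 'I_n} |
       grid_in A f & grid_equiv z.1 z.2 k f]|
   = #|A|)%N.
Proof.
case: z => x y Az; have /and3P[/= xA yA /eqP xy] := Az.
transitivity (\sum_(i < #|A|) \sum_(a < #|A|) \sum_(k < i.+1) \sum_(b in A)
   (grid_based x y i a k b : nat))%N.
  apply: eq_bigr => i _; apply: eq_bigr => a _; apply: eq_bigr => k _.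
  by rewrite (card_grid _ _ _ Az) -[LHS]sum1_card big_mkcondr.
transitivity (\sum_(b in A) \sum_(i < #|A|) \sum_(a < #|A|) \sum_(k < i.+1)
   (grid_based x y i a k b : nat))%N.
  rewrite [RHS]exchange_big /=; apply: eq_bigr => i _.
  rewrite [RHS]exchange_big /=; apply: eq_bigr => a _.
  by rewrite [RHS]exchange_big.
rewrite -[RHS]sum1_card.
apply: eq_bigr => b bA.
have [i0 [a0 [k0 [le0 based]]]] := grid_based_unique xy b.
have := based i0 a0 k0 le0; rewrite !eqxx /= => /and3P[/injectiveP inj _ _].
(* The orbit of [b] lies in [A], so [i0] and [a0] fall within the ranges of summation. *)
have le_A : (a0.+1 * i0.+1 <= #|A|)%N.
  rewrite -[a0.+1]card_ord -[i0.+1]card_ord -card_prod -(card_codom inj).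
  apply/subset_leq_card/fintype.subsetP => q /codomP[u ->].
  by rewrite /grid_map !perm_on_iter.
have lti : (i0 < #|A|)%N by apply: leq_trans le_A; rewrite leq_pmull.
have lta : (a0 < #|A|)%N by apply: leq_trans le_A; rewrite leq_pmulr.
have ltk : (k0 < i0.+1)%N by [].
rewrite (bigD1 (Ordinal lti)) //= (bigD1 (Ordinal lta)) //= (bigD1 (Ordinal ltk)) //=.
rewrite based // !eqxx /= !big1 ?addn0 // => [i ni|a na|k nk].
- apply: big1 => a _; apply: big1 => k _.
  by rewrite based -1?ltnS // -[_ == i0]/(i == Ordinal lti) (negPf ni).
- apply: big1 => k _.
  by rewrite based -1?ltnS // -[_ == a0]/(a == Ordinal lta) (negPf na) andbF.
- by rewrite based -1?ltnS // -[_ == k0]/(k == Ordinal ltk) (negPf nk) !andbF.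
Qed.

End CommutingPairs.

(** [X] copies [g] along [f] and fixes every other point. It realizes the generators of the grid as
    permutations of the ambient set. *)
Lemma extend_injective n (U : finType) (f : U -> 'I_n) (g : U -> U) :
    injective f -> injective g ->
  exists X : 'S_n, (forall u, X (f u) = f (g u)) /\ perm_on [set f u | u : U]%SET X.
Proof.
move=> f_inj g_inj.
pose h q := if [pick u | f u == q] is Some u then f (g u) else q.
have hf u : h (f u) = f (g u).
  rewrite /h; case: pickP => [v /eqP/f_inj -> //|/(_ u)]; by rewrite eqxx.
have hN q : (forall u, f u != q) -> h q = q.
  by move=> fq; rewrite /h; case: pickP => // u; rewrite (negPf (fq u)).
have imP q : (exists u, q = f u) \/ (forall u, f u != q).
  have [/codomP[u ->]|/codomP nq] := boolP (q \in codom f); first by left; exists u.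
  by right=> u; apply/eqP => e; apply: nq; exists u.
have h_inj : injective h.
  move=> p q; have [[u ->]|fp] := imP p; have [[v ->]|fq] := imP q.
  - by rewrite !hf => /f_inj/g_inj ->.
  - by rewrite hf hN // => e; have := fq (g u); rewrite e eqxx.
  - by rewrite hf hN // => e; have := fp (g v); rewrite e eqxx.
  - by rewrite !hN.
exists (perm h_inj); split=> [u|]; first by rewrite permE.
apply/fintype.subsetP => q; rewrite inE permE; apply: contraNT => fq.
by apply/eqP/hN => u; apply: contraNneq fq => <-; apply: imset_f.
Qed.

(** * Weights of commuting pairs and their restriction to invariant sets *)

Section Locality.
Variables (zeta : prim_roots) (R : comAlgType algC) (s t : nat -> R).
Variable n : nat.
Implicit Types (x y : 'S_n) (z : 'S_n * 'S_n) (A B : {set 'I_n}).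

Definition cycle_coef x y p : algC :=
  zeta #|porbit x p| ^+ findex x (froot x (y p)) (y p).

Definition pair_weight A z : R :=
  (\prod_(p in A | froots z.1 p) (cycle_coef z.1 z.2 p *: s #|porbit z.1 p|)) *
  \prod_(p in A | froots z.2 p) t #|porbit z.2 p|.

Lemma pair_weight_split A B z : B \subset A ->
  pair_weight A z = pair_weight B z * pair_weight (A :\: B) z.
Proof.
move=> /fintype.subsetP sBA; rewrite /pair_weight mulrACA.
have AB p (b : bool) : (p \in A) && b && (p \in B) = (p \in B) && b.
  by have [/sBA ->|] := boolP (p \in B); rewrite ?andbT ?andbF.
congr (_ * _); rewrite (bigID (mem B)); congr (_ * _); apply: eq_bigl => p;
  by rewrite ?AB // !inE andbC andbA.
Qed.

Section EqOn.
Variables (C : {set 'I_n}) (x x' : 'S_n).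
Hypotheses (xx' : {in C, x =1 x'}) (xC : forall p, p \in C -> x p \in C).

Lemma iter_eq_on p m : p \in C -> iter m x p = iter m x' p.
Proof.
move=> pC; elim: m => //= m <-; apply: xx'.
by elim: m => //= m; apply: xC.
Qed.

Lemma porbit_eq_on p : p \in C -> porbit x p = porbit x' p.
Proof.
move=> pC; apply/setP => q; apply/porbitP/porbitP => -[m ->]; exists m;
  by rewrite !permX iter_eq_on.
Qed.

Lemma froot_eq_on p : p \in C -> froot x p = froot x' p.
Proof.
move=> pC; congr odflt; apply: eq_pick => q.
by rewrite !fconnect_porbit porbit_eq_on.
Qed.

Lemma froots_eq_on p : p \in C -> froots x p = froots x' p.
Proof. by move=> pC; rewrite /fingraph.roots froot_eq_on. Qed.

Lemma findex_eq_on p q : p \in C -> findex x p q = findex x' p q.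
Proof.
move=> pC; rewrite /findex /fingraph.orbit !order_porbit porbit_eq_on //; congr index.
apply: (@eq_from_nth _ p); rewrite !size_traject // => m lm.
by rewrite !nth_traject // iter_eq_on.
Qed.

Lemma froot_on p : p \in C -> froot x p \in C.
Proof.
move=> pC; have := connect_root (frel x) p.
rewrite fconnect_porbit => /porbitP[m ->]; rewrite permX.
by elim: m => //= m; apply: xC.
Qed.

End EqOn.

(** Roots, cycle lengths and positions within a cycle are all read from the cycle itself, and a
    cycle that meets the invariant set [C] stays in it. *)
Lemma pair_weight_eq_on (C : {set 'I_n}) x y x' y' :
  {in C, x =1 x'} -> {in C, y =1 y'} ->
  (forall p, p \in C -> x p \in C) -> (forall p, p \in C -> y p \in C) ->
  pair_weight C (x, y) = pair_weight C (x', y').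
Proof.
move=> ex ey xC yC; rewrite /pair_weight /=; congr (_ * _).
  apply: eq_big => [p|p /andP[pC _]].
    by case: (boolP (p \in C)) => //= pC; rewrite (froots_eq_on ex).
  rewrite /cycle_coef (porbit_eq_on ex) // ey // (froot_eq_on ex) -?ey ?yC//.
  by rewrite (findex_eq_on ex) // -(froot_eq_on ex) ?yC ?froot_on ?yC.
apply: eq_big => [p|p /andP[pC _]].
  by case: (boolP (p \in C)) => //= pC; rewrite (froots_eq_on ey).
by rewrite (porbit_eq_on ey).
Qed.

End Locality.

Lemma card_porbit_dvd n (x : 'S_n) p d : (0 < d)%N ->
  (forall l, (iter l x p == p) = (d %| l)%N) -> #|porbit x p| = d.
Proof.
move=> d0 per; apply/eqP; rewrite eqn_dvd -[X in _ && X]per iter_porbit eqxx andbT.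
have o0 : (0 < #|porbit x p|)%N by rewrite lt0n card_porbit_neq0.
have : iter (d %% #|porbit x p|) x p = p.
  by rewrite iter_mod_period ?iter_porbit //; apply/eqP; rewrite per.
have := ltn_pmod d o0; rewrite /dvdn; case: (d %% _)%N => // m lm e.
have := uniq_traject_porbit x p; case: #|porbit x p| lm => // o lm.
rewrite /= => /andP[/trajectP[]]; exists m; first by [].
by rewrite -iterSr e.
Qed.

Lemma sum_froots n (x : 'S_n) (B : {set 'I_n}) : (forall p, p \in B -> x p \in B) ->
  (\sum_(p in B | froots x p) #|porbit x p| = #|B|)%N.
Proof.
move=> xB; rewrite -[RHS]sum1_card.
rewrite [RHS](partition_big (froot x) (fun p => (p \in B) && froots x p)) /=;
  last first.
  move=> p pB; rewrite froot_on //=.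
  by apply: roots_root; apply: fconnect_sym; apply: perm_inj.
apply: eq_bigr => p /andP[pB /eqP rp]; rewrite -sum1_card; apply: eq_bigl => q.
have sym : fingraph.connect_sym (frel x) by apply: fconnect_sym; apply: perm_inj.
rewrite -fconnect_porbit -root_connect // rp eq_sym.
case: eqP => [e|]; last by rewrite andbF.
rewrite andbT; apply/esym.
have : fconnect x p q by rewrite -root_connect // rp e.
rewrite fconnect_porbit => /porbitP[m ->]; rewrite permX.
by elim: m => //= m; apply: xB.
Qed.

Lemma card_froots n (x : 'S_n) (B : {set 'I_n}) d : (forall p, p \in B -> x p \in B) ->
  {in B, forall p, #|porbit x p| = d} ->
  (#|[pred p in B | froots x p]| * d = #|B|)%N.
Proof.
move=> xB xd; rewrite -(sum_froots xB) -sum_nat_const; apply: eq_big => [p|p].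
  by rewrite inE.
by rewrite inE => /andP[/xd].
Qed.

(** * The weight of a single orbit *)

Section CycleChi.
Variables (zeta : prim_roots) (n : nat) (x : 'S_n).

(** A phase on the cycles of [x]: it is 1 at each root and gains a factor zeta with each step of
    [x], consistently around the cycle because zeta has the length of the cycle as its order. *)
Definition cycle_chi p : algC := zeta #|porbit x p| ^+ findex x (froot x p) p.

Let sym : fingraph.connect_sym (frel x).
Proof. exact: (fconnect_sym perm_inj). Qed.

Lemma card_porbit_froot p : #|porbit x (froot x p)| = #|porbit x p|.
Proof.
have := connect_root (frel x) p.
by rewrite fconnect_porbit => /porbitP[m ->]; rewrite porbit_perm.
Qed.

Lemma cycle_chi_iter m p :
  cycle_chi (iter m x p) = cycle_chi p * zeta #|porbit x p| ^+ m.
Proof.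
rewrite /cycle_chi -exprD -permX porbit_perm permX.
have -> : froot x (iter m x p) = froot x p.
  by apply/eqP; rewrite root_connect // sym fconnect_iter.
rewrite -card_porbit_froot; apply: zeta_findex.
by rewrite sym connect_root.
Qed.

Lemma cycle_chi_root p : froots x p -> cycle_chi p = 1.
Proof. by move=> /eqP rp; rewrite /cycle_chi rp findex0 expr0. Qed.

Lemma zeta_porbit_neq0 p : zeta #|porbit x p| != 0.
Proof.
have := oner_neq0 algC; rewrite -(zeta_order zeta x p) expf_eq0.
by rewrite lt0n card_porbit_neq0.
Qed.

Lemma cycle_chi_neq0 p : cycle_chi p != 0.
Proof. exact/expf_neq0/zeta_porbit_neq0. Qed.

(** Moving [q] along its cycle multiplies both phases by the same root of unity, since [y] commutes
    with [x] and preserves cycle lengths. The coefficient at a root can thus be computed at any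
    point of the cycle. *)
Lemma cycle_coef_root y q : (x * y = y * x)%g ->
  cycle_coef zeta x y (froot x q) = cycle_chi (y q) / cycle_chi q.
Proof.
move=> xy; have xyq w : x (y w) = y (x w) by rewrite -!permM xy.
have := connect_root (frel x) q; rewrite sym => /iter_findex.
set p := froot x q; set m := findex x p q => eq.
have yC : y \in 'C[x]%g by apply/cent1P.
have -> : cycle_coef zeta x y p = cycle_chi (y p).
  by rewrite /cycle_coef /cycle_chi card_porbit_cent.
have chi_p : cycle_chi p = 1 by apply: cycle_chi_root; apply: roots_root.
rewrite -eq -iterC // !cycle_chi_iter chi_p mul1r card_porbit_cent //.
by rewrite mulfK // expf_neq0 // zeta_porbit_neq0.
Qed.

End CycleChi.

Section GridWeight.
Variables (zeta : prim_roots) (R : comAlgType algC) (s t : nat -> R).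
Variables (n : nat) (x y : 'S_n) (i a k : nat).
Variable f : 'I_a.+1 * 'I_i.+1 -> 'I_n.
Hypotheses (xy : (x * y = y * x)%g) (f_inj : injective f).
Hypothesis fxy : grid_equiv x y k f.
Let B : {set 'I_n} := [set f u | u : 'I_a.+1 * 'I_i.+1]%SET.
Let b := f (ord0, ord0).

Let fx u : x (f u) = f (grid_x u). Proof. by case/grid_equivP: fxy. Qed.
Let fy u : y (f u) = f (grid_y k u). Proof. by case/grid_equivP: fxy. Qed.

Let iter_fx m u : iter m x (f u) = f (u.1, iter m (@ordS _) u.2).
Proof. by elim: m => [|m /= ->]; [case: u | rewrite fx]. Qed.

Let f_map u : f u = iter u.2 x (iter u.1 y b).
Proof. have [e _ _] := grid_equiv_map fxy; exact: e. Qed.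

Let iter_b : iter a.+1 y b = iter k x b.
Proof. by have [_ _ e] := grid_equiv_map fxy. Qed.

Let xyi m l q : iter m x (iter l y q) = iter l y (iter m x q).
Proof.
have e q' : x (y q') = y (x q') by rewrite -!permM xy.
by rewrite iterC // => q'; rewrite -iterC.
Qed.

Let xB p : p \in B -> x p \in B.
Proof. by case/imsetP=> u _ ->; rewrite fx imset_f. Qed.

Let yB p : p \in B -> y p \in B.
Proof. by case/imsetP=> u _ ->; rewrite fy imset_f. Qed.

Let cardB : #|B| = (a.+1 * i.+1)%N.
Proof. by rewrite card_imset // card_prod !card_ord. Qed.

Let card_porbit_x p : p \in B -> #|porbit x p| = i.+1.
Proof.
case/imsetP=> -[r v] _ ->; apply: card_porbit_dvd => // l; rewrite iter_fx.
rewrite (inj_eq f_inj) xpair_eqE eqxx /= -val_eqE /= iter_ordS.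
rewrite -[X in _ == X](@modn_small v i.+1) // -[X in _ == (X %% _)%N]addn0 eqn_modDl.
by rewrite mod0n.
Qed.

Let divn_gcd_gt0 : (0 < i.+1 %/ gcdn i.+1 k)%N.
Proof. by rewrite divn_gt0 ?gcdn_gt0 //; apply: dvdn_leq (dvdn_gcdl _ _). Qed.

(** Write [l] as q (a + 1) + r. A return to the row of [b] forces r = 0, and then the power of [y]
    acts as [x] to the k q, which fixes [b] exactly when i + 1 divides k q. *)
Let iter_y_b l : (iter l y b == b) = (a.+1 * (i.+1 %/ gcdn i.+1 k) %| l)%N.
Proof.
have e q r : iter (r + q * a.+1) y b = iter (k * q) x (iter r y b).
  rewrite iterD xyi; congr (iter _ _ _); elim: q => [|q IH]; first by rewrite muln0.
  by rewrite mulSn addnC iterD iter_b -xyi IH mulnS iterD.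
rewrite (divn_eq l a.+1) addnC e; set q := (l %/ a.+1)%N.
have lt_r : (l %% a.+1 < a.+1)%N by rewrite ltn_mod.
have -> : iter (l %% a.+1) y b = f (Ordinal lt_r, ord0) by rewrite f_map.
rewrite iter_fx (inj_eq f_inj) xpair_eqE -!val_eqE /= iter_ordS add0n.
set d := (i.+1 %/ gcdn i.+1 k)%N.
have g0 : (0 < gcdn i.+1 k)%N by rewrite gcdn_gt0.
have [r0|r0] /= := eqVneq (l %% a.+1)%N 0%N; last first.
  apply/esym/negP => /(dvdn_trans (dvdn_mulr d (dvdnn a.+1))).
  by rewrite dvdn_addl ?dvdn_mull // /dvdn modn_mod (negPf r0).
rewrite r0 add0n [(q * _)%N]mulnC dvdn_pmul2l // -/(dvdn _ _).
rewrite -{1}(divnK (dvdn_gcdl i.+1 k)) -/d -{2}(divnK (dvdn_gcdr i.+1 k)).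
rewrite mulnAC dvdn_pmul2r // Gauss_dvdr //.
by rewrite /coprime -(eqn_pmul2r g0) mul1n muln_gcdl !divnK ?dvdn_gcdl ?dvdn_gcdr.
Qed.

(** Every point of the orbit is the image of [b] under a permutation commuting with [y], so all
    cycles of [y] on it have the same length. *)
Let card_porbit_y p : p \in B ->
  #|porbit y p| = (a.+1 * (i.+1 %/ gcdn i.+1 k))%N.
Proof.
case/imsetP=> u _ ->; apply: card_porbit_dvd => [|l].
  by rewrite muln_gt0 divn_gcd_gt0.
rewrite -iter_y_b f_map -xyi -iterD addnC iterD -!permX.
by rewrite !(inj_eq perm_inj).
Qed.

Let sym : fingraph.connect_sym (frel x).
Proof. exact: (fconnect_sym perm_inj). Qed.

Local Notation chi := (cycle_chi zeta x).

Let fB u : f u \in B. Proof. exact: imset_f. Qed.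

Let yb_f (r : 'I_a.+1) : iter r y b = f (r, ord0).
Proof. by rewrite f_map. Qed.

(** Each row of the grid is one cycle of [x]. Evaluated at the first cell of each row, the
    coefficients telescope to the ratio of the phases of [iter a.+1 y b = iter k x b] and of [b]. *)
Lemma grid_coef : \prod_(p in B | froots x p) cycle_coef zeta x y p = zeta i.+1 ^+ k.
Proof.
pose h (r : 'I_a.+1) := froot x (f (r, ord0)).
have h_inj : injective h.
  move=> r r' /eqP; rewrite root_connect // fconnect_porbit => /porbitP[m].
  by rewrite permX iter_fx => /f_inj[].
have hE : [set p in B | froots x p]%SET = [set h r | r : 'I_a.+1]%SET.
  apply/setP => p; rewrite inE; apply/andP/imsetP => [[/imsetP[u _ ->]]|[r _ ->]].
    move=> /eqP ru; exists u.1 => //; rewrite -[LHS]ru; apply/eqP.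
    by rewrite root_connect // sym fconnect_porbit (f_map u) yb_f -permX mem_porbit.
  by split; [apply: froot_on | apply: roots_root].
transitivity (\prod_(p in [set h r | r : 'I_a.+1]%SET) cycle_coef zeta x y p).
  by rewrite -hE; apply: eq_bigl => p; rewrite !inE.
rewrite big_imset /=; last by move=> ? ? _ _; apply: h_inj.
under eq_bigr => r _ do rewrite cycle_coef_root // -yb_f -iterS.
under eq_bigl do rewrite inE.
rewrite -(big_mkord xpredT (fun r => chi (iter r.+1 y b) / chi (iter r y b))).
rewrite (telescope_prodf (fun m _ => cycle_chi_neq0 zeta x (iter m y b))) //.
by rewrite iter_b cycle_chi_iter card_porbit_x ?fB //= mulrC mulKf ?cycle_chi_neq0.
Qed.

(** On the orbit all cycles of [x] have one length and all cycles of [y] have another, so their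
    numbers follow by dividing the size of the orbit. *)
Lemma grid_weight : pair_weight zeta s t B (x, y) =
  zeta i.+1 ^+ k *: (s i.+1 ^+ a.+1 *
    t (a.+1 * (i.+1 %/ gcdn i.+1 k))%N ^+ gcdn i.+1 k).
Proof.
rewrite /pair_weight /=.
have -> : \prod_(p in B | froots x p) (cycle_coef zeta x y p *: s #|porbit x p|) =
    (zeta i.+1 ^+ k) *: s i.+1 ^+ a.+1.
  rewrite scaler_prod grid_coef; congr (_ *: _).
  under eq_bigr => p /andP[pB _] do rewrite card_porbit_x //.
  rewrite prodr_const; congr (_ ^+ _).
  have := card_froots xB card_porbit_x; rewrite cardB => /eqP.
  by rewrite eqn_pmul2r // => /eqP <-; apply: eq_card => p; rewrite inE.
rewrite -scalerAl; congr (_ *: (_ * _)).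
under eq_bigr => p /andP[pB _] do rewrite card_porbit_y //.
rewrite prodr_const; congr (_ ^+ _).
have := card_froots yB card_porbit_y; rewrite cardB.
have -> : (a.+1 * i.+1 = gcdn i.+1 k * (a.+1 * (i.+1 %/ gcdn i.+1 k)))%N.
  by rewrite mulnCA [(gcdn _ _ * _)%N]mulnC divnK // dvdn_gcdl.
move/eqP; rewrite eqn_pmul2r ?muln_gt0 ?divn_gcd_gt0 // => /eqP <-.
by apply: eq_card => p; rewrite inE.
Qed.

End GridWeight.

(** * The recursion obtained by removing an orbit *)

Section Recursion.
Variables (zeta : prim_roots) (R : comAlgType algC) (s t : nat -> R).

Definition comm_sum n (A : {set 'I_n}) : R :=
  \sum_(z | comm_pair A z) pair_weight zeta s t A z.

Definition grid_term (i a k : nat) : R :=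
  zeta i.+1 ^+ k *: (s i.+1 ^+ a.+1 *
    t (a.+1 * (i.+1 %/ gcdn i.+1 k))%N ^+ gcdn i.+1 k).

Section Translate.
Variables (n : nat) (A : {set 'I_n}) (i a k : nat).
Variable f : 'I_a.+1 * 'I_i.+1 -> 'I_n.
Hypotheses (f_inj : injective f) (fA : forall u, f u \in A).
Let B : {set 'I_n} := [set f u | u : 'I_a.+1 * 'I_i.+1]%SET.

Let sBA : B \subset A.
Proof. by apply/fintype.subsetP => _ /imsetP[u _ ->]. Qed.

(** In [X * z] the factor [X] acts first and maps [B] onto itself, so the product agrees with [X] on
    [B] exactly when [z] fixes [B] pointwise. *)
Let fixes (g : 'I_a.+1 * 'I_i.+1 -> 'I_a.+1 * 'I_i.+1) (X z : 'S_n) : injective g ->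
  (forall u, X (f u) = f (g u)) -> perm_on B X ->
  (perm_on A (X * z)%g && [forall u, (X * z)%g (f u) == f (g u)]) =
  perm_on (A :\: B) z.
Proof.
move=> g_inj Xf XB; apply/andP/idP => [[zA /forallP zf]|zAB].
  apply/fintype.subsetP => q; rewrite inE; apply: contraNT; rewrite !inE negb_and negbK.
  case/orP => [/imsetP[u _ ->]|qA].
    have [h _ gh] := injF_bij g_inj.
    by have := zf (h u); rewrite permM Xf gh.
  have qB : q \notin B by apply: contraNN qA => /(fintype.subsetP sBA).
  by have := out_perm zA qA; rewrite permM (out_perm XB qB) => /eqP.
split.
  apply: perm_onM; first exact: fintype.subset_trans XB sBA.
  exact: fintype.subset_trans zAB (subsetDl A B).
apply/forallP => u; rewrite permM Xf (out_perm zAB) //.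
by rewrite !inE imset_f.
Qed.

(** Left translation by the model pair [(X, Y)] is a bijection from the commuting pairs on [A :\: B]
    to those that act on [B] as the grid, and the weight splits along [B]. *)
Lemma sum_comm_pair_grid :
  \sum_(z | comm_pair A z && grid_equiv z.1 z.2 k f) pair_weight zeta s t A z =
  grid_term i a k * comm_sum (A :\: B).
Proof.
have [X [Xf XB]] := extend_injective f_inj (@grid_x_inj i a).
have [Y [Yf YB]] := extend_injective f_inj (@grid_y_inj i a k).
have XY : (X * Y = Y * X)%g.
  apply/permP => q; rewrite !permM; have [/imsetP[u _ ->]|qB] := boolP (q \in B).
    by rewrite Xf !Yf Xf grid_xyC.
  by rewrite (out_perm XB qB) (out_perm YB qB) (out_perm XB qB).
have disj : [disjoint B & A :\: B].
  by apply/pred0P => q /=; rewrite inE; have [] := boolP (q \in B).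
pose h (z : 'S_n * 'S_n) := ((X * z.1)%g, (Y * z.2)%g).
have h_inj : injective h by move=> [z1 z2] [w1 w2] [/mulgI-> /mulgI->].
have E z : comm_pair A (h z) && grid_equiv (h z).1 (h z).2 k f = comm_pair (A :\: B) z.
  case: z => z1 z2; rewrite /comm_pair /h /=.
  transitivity [&& perm_on (A :\: B) z1, perm_on (A :\: B) z2
      & (X * z1 * (Y * z2) == Y * z2 * (X * z1))%g].
    rewrite -(fixes z1 (@grid_x_inj i a) Xf XB).
    rewrite -(fixes z2 (@grid_y_inj i a k) Yf YB).
    have -> : grid_equiv (X * z1)%g (Y * z2)%g k f =
        [forall u, (X * z1)%g (f u) == f (grid_x u)] &&
        [forall u, (Y * z2)%g (f u) == f (grid_y k u)].
      apply/grid_equivP/andP => [[h1 h2]|[/forallP h1 /forallP h2]].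
        by split; apply/forallP => u; rewrite ?h1 ?h2.
      by split=> u; apply/eqP.
    by rewrite -!andbA; do !bool_congr.
  case z1AB: (perm_on _ z1) => //=; case z2AB: (perm_on _ z2) => //=.
  (* Permutations with disjoint supports commute, so with [XY] the condition reduces to the
     commutation of [z1] and [z2]. *)
  rewrite -mulgA (mulgA z1) -(perm_onC YB z1AB disj) -[(Y * z2 * _)%g]mulgA (mulgA z2).
  rewrite -(perm_onC XB z2AB disj) !mulgA XY -!mulgA.
  by rewrite !(inj_eq (mulgI _)).
rewrite (reindex_inj h_inj) /comm_sum mulr_sumr; apply: eq_big => [z|z]; first exact: E.
move=> zA; have := zA; rewrite E => zAB.
case: z zA zAB => z1 z2 /andP[/and3P[/= z1A z2A /eqP z12] equiv] /and3P[/= z1AB z2AB _].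
rewrite (pair_weight_split _ _ _ _ sBA); congr (_ * _).
  exact: grid_weight z12 f_inj equiv.
apply: pair_weight_eq_on => p pAB.
- by rewrite permM (out_perm XB) //; move: pAB; rewrite inE => /andP[].
- by rewrite permM (out_perm YB) //; move: pAB; rewrite inE => /andP[].
- have pB : p \notin B by move: pAB; rewrite inE => /andP[].
  by rewrite permM (out_perm XB pB) perm_closed.
- have pB : p \notin B by move: pAB; rewrite inE => /andP[].
  by rewrite permM (out_perm YB pB) perm_closed.
Qed.

End Translate.

(** Double counting of a commuting pair together with an equivariant injection: each pair occurs
    [#|A|] times by [sum_card_grid], and for each injection the pairs are summed by
    [sum_comm_pair_grid]. *)
Lemma comm_sum_grid n (A : {set 'I_n}) :
  #|A|%:R * comm_sum A =
  \sum_(i < #|A|) \sum_(a < #|A|) \sum_(k < i.+1)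
    \sum_(f : {ffun 'I_a.+1 * 'I_i.+1 -> 'I_n} | grid_in A f)
       grid_term i a k * comm_sum (A :\: [set f u | u : 'I_a.+1 * 'I_i.+1]%SET).
Proof.
rewrite mulr_sumr.
transitivity (\sum_(z | comm_pair A z) \sum_(i < #|A|) \sum_(a < #|A|) \sum_(k < i.+1)
    \sum_(f : {ffun 'I_a.+1 * 'I_i.+1 -> 'I_n} | grid_in A f && grid_equiv z.1 z.2 k f)
      pair_weight zeta s t A z).
  apply: eq_bigr => z zA; rewrite mulr_natl -{1}(sum_card_grid zA) -sumrMnr.
  apply: eq_bigr => i _; rewrite -sumrMnr.
  apply: eq_bigr => a _; rewrite -sumrMnr.
  apply: eq_bigr => k _; rewrite -sumr_const.
  by apply: eq_bigl => f; rewrite inE.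
rewrite exchange_big; apply: eq_bigr => i _.
rewrite exchange_big; apply: eq_bigr => a _.
rewrite exchange_big; apply: eq_bigr => k _ /=.
rewrite (exchange_big_dep (@grid_in n i a A)) /=; last by move=> z f _ /andP[].
apply: eq_bigr => f /andP[/injectiveP f_inj /forallP fA].
rewrite -sum_comm_pair_grid //; apply: eq_bigl => z; congr (_ && _).
by rewrite /grid_in; have /injectiveP -> := f_inj; have /forallP -> := fA.
Qed.

Lemma card_grid_in n i a (A : {set 'I_n}) :
  #|[pred f : {ffun 'I_a.+1 * 'I_i.+1 -> 'I_n} | grid_in A f]|
  = (#|A| ^_ (a.+1 * i.+1))%N.
Proof.
have -> : (a.+1 * i.+1 = #|{: 'I_a.+1 * 'I_i.+1}|)%N by rewrite card_prod !card_ord.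
rewrite -card_inj_ffuns_on.
by apply: eq_card => f; rewrite !inE andbC; congr (_ && _).
Qed.

(** [c] is abstract because [comm_sum_card], by which the sum depends only on the cardinality, is
    itself proved from this recursion. For a grid larger than [A] the falling factorial is 0, so the
    truncated subtraction does no harm. *)
Lemma comm_sum_rec n (A : {set 'I_n}) (c : nat -> R) :
  (forall C : {set 'I_n}, (#|C| < #|A|)%N -> comm_sum C = c #|C|) ->
  #|A|%:R * comm_sum A =
  \sum_(i < #|A|) \sum_(a < #|A|) \sum_(k < i.+1)
    (#|A| ^_ (a.+1 * i.+1))%:R * (grid_term i a k * c (#|A| - a.+1 * i.+1)%N).
Proof.
move=> cE; rewrite comm_sum_grid; apply: eq_bigr => i _; apply: eq_bigr => a _.
apply: eq_bigr => k _; rewrite -card_grid_in mulr_natl -sumr_const.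
apply: eq_big => [f|f /andP[/injectiveP f_inj /forallP fA]]; first by rewrite inE.
have cB : #|[set f u | u : 'I_a.+1 * 'I_i.+1]%SET| = (a.+1 * i.+1)%N.
  by rewrite card_imset // card_prod !card_ord.
have cD : #|A :\: [set f u | u : 'I_a.+1 * 'I_i.+1]%SET| = (#|A| - a.+1 * i.+1)%N.
  rewrite cardsD -cB; congr (_ - #|pred_of_set _|)%N; apply/finset.setIidPr.
  by apply/fintype.subsetP => _ /imsetP[u _ ->].
have le : (a.+1 * i.+1 <= #|A|)%N.
  by rewrite -cB; apply/subset_leq_card/fintype.subsetP => _ /imsetP[u _ ->].
by rewrite cE cD // ltn_subrL muln_gt0 /=; apply: leq_trans le.
Qed.

Lemma comm_sum0 n : comm_sum (finset.set0 : {set 'I_n}) = 1.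
Proof.
have E (x : 'S_n) : perm_on finset.set0 x = (x == 1%g).
  apply/idP/eqP => [x0|->]; last exact: perm_on1.
  by apply/permP => p; rewrite perm1 (out_perm x0) // inE.
rewrite /comm_sum (big_pred1 (1%g, 1%g)) => [|[x y]].
  by rewrite /pair_weight !big1 ?mulr1 // => p; rewrite inE.
rewrite /comm_pair !E /= xpair_eqE.
by case: eqP => // ->; case: eqP => // ->; rewrite eqxx.
Qed.

Lemma natr_scaleK N (u : R) : (0 < N)%N -> (N%:R)^-1 *: (N%:R * u) = u.
Proof.
move=> N0; rewrite mulr_natl -scaler_nat scalerA mulVf ?scale1r //.
by rewrite pnatr_eq0 -lt0n.
Qed.

(** Both sides obey the same recursion, so induction on the cardinality replaces a relabelling of
    the points. *)
Lemma comm_sum_card n (A : {set 'I_n}) :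
  comm_sum A = comm_sum (finset.setT : {set 'I_#|A|}).
Proof.
move: {2}#|A| (erefl #|A|) => N; elim/ltn_ind: N n A => N IH n A cA.
have [N0|N0] := posnP N.
  have -> : A = finset.set0 by apply: cards0_eq; rewrite cA.
  have -> : (finset.setT : {set 'I_#|(finset.set0 : {set 'I_n})|}) = finset.set0.
    by apply: cards0_eq; rewrite cardsT card_ord cards0.
  by rewrite !comm_sum0.
pose c m := comm_sum (finset.setT : {set 'I_m}).
have cE m (C : {set 'I_m}) : (#|C| < #|A|)%N -> comm_sum C = c #|C|.
  by rewrite cA => lt; apply: IH lt _ _ erefl.
have N0' : (0 < #|A|)%N by rewrite cA.
rewrite -[LHS](natr_scaleK _ N0') -[RHS](natr_scaleK _ N0').
congr (_ *: _); rewrite (@comm_sum_rec _ _ c); last exact: cE.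
have cT : #|(finset.setT : {set 'I_#|A|})| = #|A| by rewrite cardsT card_ord.
have := @comm_sum_rec _ (finset.setT : {set 'I_#|A|}) c; rewrite cT => -> //.
exact: cE.
Qed.

Definition comm_series n : R := (n`!%:R)^-1 *: comm_sum (finset.setT : {set 'I_n}).

Lemma comm_series0 : comm_series 0 = 1.
Proof.
rewrite /comm_series fact0 invr1 scale1r.
have -> : (finset.setT : {set 'I_0}) = finset.set0.
  by apply: cards0_eq; rewrite cardsT card_ord.
exact: comm_sum0.
Qed.

(** Dividing by n! turns the falling factorial of length m into the 1 / (n - m)! contained in the
    smaller term. *)
Lemma comm_series_rec n :
  n%:R * comm_series n = \sum_(i < n) \sum_(a < n | (a.+1 * i.+1 <= n)%N)
    (\sum_(k < i.+1) grid_term i a k) * comm_series (n - a.+1 * i.+1).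
Proof.
pose c m := comm_sum (finset.setT : {set 'I_m}).
have cT : #|(finset.setT : {set 'I_n})| = n by rewrite cardsT card_ord.
have /= := @comm_sum_rec _ (finset.setT : {set 'I_n}) c; rewrite cT => e.
rewrite /comm_series -scalerAr e; last by move=> C _; apply: comm_sum_card.
rewrite scaler_sumr; apply: eq_bigr => i _.
rewrite scaler_sumr [RHS]big_mkcond; apply: eq_bigr => a _.
case: (leqP (a.+1 * i.+1) n) => [le|lt]; last first.
  by rewrite big1 ?scaler0 // => k _; rewrite ffact_small // mul0r.
rewrite mulr_suml scaler_sumr; apply: eq_bigr => k _.
rewrite mulr_natl -scaler_nat scalerA -scalerAr; congr (_ *: _).
rewrite -(ffact_fact le) natrM invfM mulrAC mulVf ?mul1r //.
by rewrite pnatr_eq0 -lt0n ffact_gt0.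
Qed.

End Recursion.

(** * Ramanujan sums *)

Lemma mobius_sqr p d : prime p -> (0 < d)%N -> (p ^ 2 %| d)%N -> mobius d = 0.
Proof.
move=> pp d0 pd; rewrite /mobius ifF //; apply/negbTE/allPn; exists p.
  by rewrite mem_primes pp d0 (dvdn_trans _ pd) // dvdn_exp.
by rewrite neq_ltn orbC; move: pd; rewrite pfactor_dvdn // => ->.
Qed.

Lemma mobius_pM p d : prime p -> (0 < d)%N -> ~~ (p %| d)%N ->
  mobius (p * d) = - mobius d.
Proof.
move=> pp d0 pd; have p0 := prime_gt0 pp.
have pN : p \notin primes d by rewrite mem_primes pp d0 (negPf pd).
have perm_pr : perm_eq (primes (p * d)) (p :: primes d).
  apply: uniq_perm; rewrite ?primes_uniq //= ?pN ?primes_uniq //.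
  by move=> q; rewrite primesM // primes_prime // !inE.
rewrite /mobius (perm_all _ perm_pr) (perm_size perm_pr) /=.
have -> : (logn p (p * d) == 1)%N.
  by rewrite lognM // (logn_prime _ pp) eqxx [logn p d]lognE pp d0 (negPf pd).
have -> : all (fun q => logn q (p * d) == 1%N) (primes d)
        = all (fun q => logn q d == 1%N) (primes d).
  apply: eq_in_all => q qd; rewrite lognM // logn_prime //.
  by have [eq|] := eqVneq q p; first by move: pN; rewrite -eq qd.
by rewrite /=; case: ifP => _; rewrite ?oppr0 // exprS mulN1r.
Qed.

(** Fix a prime p dividing n. Divisors divisible by p ^ 2 contribute 0, and each divisor d prime to
    p cancels against p d. *)
Lemma sum_mobius n : (0 < n)%N -> \sum_(d <- divisors n) mobius d = (n == 1%N)%:R.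
Proof.
move=> n0; have [->|n1] := eqVneq n 1%N; first by rewrite big_seq1.
have n_gt1 : (1 < n)%N by case: n n0 n1 => [|[]].
set p := pdiv n; have pp : prime p by apply: pdiv_prime.
have pn : (p %| n)%N by apply: pdiv_dvd.
have dvd_gt0 d : (d %| n)%N -> (0 < d)%N by apply: dvdn_gt0.
rewrite (bigID (fun d => p %| d)%N) /= (bigID (fun d => p ^ 2 %| d)%N) /=.
rewrite big_seq_cond big1 ?add0r => [|d]; last first.
  case/andP; rewrite -dvdn_divisors // => /dvd_gt0 d0 /andP[_]; exact: mobius_sqr.
rewrite -big_filter.
have -> : \sum_(d <- [seq d <- divisors n | (p %| d) && ~~ (p ^ 2 %| d)]%N) mobius d =
    \sum_(d <- [seq (p * d)%N | d <- [seq d <- divisors n | ~~ (p %| d)%N]]) mobius d.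
  apply: perm_big; apply: uniq_perm.
  - exact/filter_uniq/divisors_uniq.
  - rewrite map_inj_uniq ?filter_uniq ?divisors_uniq // => d d' /eqP.
    by rewrite eqn_pmul2l ?prime_gt0 // => /eqP.
  - move=> d; rewrite mem_filter; apply/andP/mapP => [[/andP[pd p2d]]|[d' ]].
      rewrite -dvdn_divisors // => dn; exists (d %/ p)%N; last by rewrite mulnC divnK.
      rewrite mem_filter -dvdn_divisors // (dvdn_trans _ dn) ?dvdn_div // andbT.
      by apply: contraNN p2d => h; rewrite -(divnK pd) expnS expn1 dvdn_mul.
    rewrite mem_filter -dvdn_divisors // => /andP[pd' dn] ->.
    rewrite dvdn_mulr // expnS expn1 dvdn_pmul2l ?prime_gt0 // pd'.
    by rewrite -dvdn_divisors // Gauss_dvd ?pn // prime_coprime.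
rewrite big_map big_filter -big_split /= big_seq_cond big1 // => d.
rewrite -dvdn_divisors // => /andP[/dvd_gt0 d0 pd].
by rewrite mobius_pM // addNr.
Qed.

Section RamanujanSum.
Variable V : zmodType.

(** These are the fractions k / n with denominator [e] in lowest terms. The term k = 0 belongs to e
    = 1, where [coprime 1 0] holds. *)
Lemma sum_gcd_fiber (F : nat -> V) n e : (0 < n)%N -> (e %| n)%N ->
  \sum_(0 <= k < n | (n %/ gcdn n k)%N == e) F k =
  \sum_(0 <= u < e | coprime e u) F (n %/ e * u)%N.
Proof.
move=> n0 en; have e0 := dvdn_gt0 n0 en; set q := (n %/ e)%N.
have q0 : (0 < q)%N by rewrite divn_gt0 // dvdn_leq.
have nE : n = (q * e)%N by rewrite divnK.
rewrite -big_filter -[RHS]big_filter.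
rewrite -(big_map (fun u => q * u)%N xpredT F); apply: perm_big; apply: uniq_perm.
- by rewrite filter_uniq // iota_uniq.
- rewrite map_inj_uniq ?filter_uniq ?iota_uniq // => u v /eqP.
  by rewrite eqn_pmul2l // => /eqP.
move=> k; rewrite mem_filter mem_index_iota /=; apply/andP/mapP => [[/eqP g lt]|[u]].
  have gE : gcdn n k = q by rewrite /q -g divnA ?dvdn_gcdl // mulKn.
  have qk : (q %| k)%N by rewrite -gE dvdn_gcdr.
  exists (k %/ q)%N; last by rewrite mulnC divnK.
  rewrite mem_filter mem_index_iota /= ltn_divLR // mulnC -nE lt andbT.
  by rewrite /coprime -(eqn_pmul2l q0) muln1 muln_gcdr -nE mulnC divnK // gE.
rewrite mem_filter mem_index_iota /= => /andP[cop lt] ->.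
have -> : gcdn n (q * u) = q by rewrite [X in gcdn X]nE -muln_gcdr (eqP cop) muln1.
by rewrite [X in (_ < X)%N]nE ltn_pmul2l // lt [X in (X %/ q)%N]nE mulKn.
Qed.

Lemma sum_gcd (F : nat -> V) n : (0 < n)%N ->
  \sum_(0 <= k < n) F k =
  \sum_(e <- divisors n) \sum_(0 <= u < e | coprime e u) F (n %/ e * u)%N.
Proof.
move=> n0.
transitivity (\sum_(e <- divisors n)
    \sum_(0 <= k < n | (n %/ gcdn n k)%N == e) F k); last first.
  rewrite big_seq [RHS]big_seq; apply: eq_bigr => e en.
  by rewrite sum_gcd_fiber // dvdn_divisors.
rewrite [RHS](exchange_big_dep xpredT) //=; apply: eq_bigr => k _.
rewrite -big_filter (_ : [seq _ <- _ | _] = [:: (n %/ gcdn n k)%N]) ?big_seq1 //.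
have dv : (n %/ gcdn n k)%N \in divisors n.
  by rewrite -dvdn_divisors // dvdn_div // dvdn_gcdl.
have -> : [seq e <- divisors n | (n %/ gcdn n k)%N == e] =
          [seq e <- divisors n | pred1 (n %/ gcdn n k)%N e].
  by apply: eq_filter => e; rewrite /= eq_sym.
by rewrite filter_pred1_uniq // divisors_uniq.
Qed.

End RamanujanSum.

(** Summed over the divisors of [n], both sides give 1 or 0 according to whether n = 1; on the left
    this is the sum of all powers of [z], grouped by order. The proper divisors agree by induction,
    which leaves the terms at [n]. *)
Lemma sum_primitive_powers n (z : algC) : (0 < n)%N -> n.-primitive_root z ->
  \sum_(0 <= u < n | coprime n u) z ^+ u = (mobius n)%:~R.
Proof.
elim/ltn_ind: n z => n IH z n0 zn.
have s1 : \sum_(0 <= k < n) z ^+ k = (n == 1%N)%:R.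
  have [e1|n1] := eqVneq n 1%N; first by rewrite e1 big_nat1 expr0.
  have z1 : z - 1 != 0.
    rewrite subr_eq0; apply: contraNneq n1 => z1.
    by have := prim_order_dvd zn 1; rewrite z1 expr1 eqxx dvdn1.
  apply: (mulfI z1); rewrite mulr0 big_mkord -subrX1 (prim_expr_order zn).
  exact: subrr.
have nn : n \in divisors n by rewrite -dvdn_divisors.
have s2 : \sum_(d <- divisors n) (mobius d)%:~R = (n == 1%N)%:R :> algC.
  by rewrite -rmorph_sum /= sum_mobius //; case: eqP.
have E e : e \in divisors n -> \sum_(0 <= u < e | coprime e u) z ^+ (n %/ e * u) =
    \sum_(0 <= u < e | coprime e u) (z ^+ (n %/ e)) ^+ u.
  by move=> _; apply: eq_bigr => u _; rewrite exprM.
have IHr : \sum_(e <- rem n (divisors n))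
      \sum_(0 <= u < e | coprime e u) z ^+ (n %/ e * u) =
    \sum_(e <- rem n (divisors n)) (mobius e)%:~R.
  rewrite big_seq [RHS]big_seq; apply: eq_bigr => e.
  rewrite mem_rem_uniq ?divisors_uniq // !inE -dvdn_divisors // => /andP[ne en].
  rewrite E -?dvdn_divisors // IH ?(dvdn_gt0 n0) //; last exact: dvdn_prim_root.
  by rewrite ltn_neqAle ne dvdn_leq.
move: s1; rewrite -s2 sum_gcd // (big_rem n) //= IHr [RHS](big_rem n) //=.
by move/addIr; rewrite E // divnn n0 expr1.
Qed.

(** [n %/ gcdn n k] is the order of [z ^+ k], so each value [G e] is multiplied by the sum of the
    primitive [e]-th roots of unity. *)
Lemma sum_root_gcd (V : lmodType algC) n (z : algC) (G : nat -> V) : (0 < n)%N ->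
  n.-primitive_root z ->
  \sum_(k < n) z ^+ k *: G (n %/ gcdn n k)%N =
  \sum_(e <- divisors n) (mobius e)%:~R *: G e.
Proof.
move=> n0 zn; rewrite -(big_mkord xpredT (fun k => z ^+ k *: G (n %/ gcdn n k)%N)).
rewrite sum_gcd // big_seq [RHS]big_seq; apply: eq_bigr => e.
rewrite -dvdn_divisors // => en.
have e0 := dvdn_gt0 n0 en.
have q0 : (0 < n %/ e)%N by rewrite divn_gt0 // dvdn_leq.
rewrite -(sum_primitive_powers e0 (dvdn_prim_root zn en)) scaler_suml.
apply: eq_bigr => u cop; rewrite -exprM; congr (_ *: G _).
by rewrite -{1 2}(divnK en) -muln_gcdr (eqP cop) muln1 mulKn.
Qed.

(** * The Euler derivation on power series *)

Section Euler.
Local Open Scope classical_set_scope.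
Local Open Scope mset_scope.
Variables (I : choiceType) (wt : I -> nat).
Implicit Types (m : {mset I}).

Definition mset_wt m : nat := \sum_(x <- (m : seq I)) wt x.

Lemma mset_wtD m1 m2 : mset_wt (m1 `+` m2) = (mset_wt m1 + mset_wt m2)%N.
Proof.
rewrite /mset_wt -big_cat; apply: perm_big; apply/allP => x _ /=.
by rewrite count_cat !count_mem_mset msetE2.
Qed.

Lemma mset_wtn k x : mset_wt (msetn k x) = (k * wt x)%N.
Proof. by rewrite /mset_wt enum_msetn big_nseq iter_addn_0 mulnC. Qed.

Lemma mset_wt0 : mset_wt mset0 = 0%N.
Proof. by rewrite /mset_wt enum_mset0 big_nil. Qed.

Section Ring.
Variable R : comNzRingType.
Implicit Types (f g h : fps I R).

Definition fps_euler f : fps I R := fun m => f m *+ mset_wt m.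

Lemma fps_eulerD f g : fps_euler (f + g) = fps_euler f + fps_euler g.
Proof. by apply: fpsP => m; rewrite /fps_euler !fps_coefD mulrnDl. Qed.

Lemma fps_eulerZ (k : R) f : fps_euler (k *: f) = k *: fps_euler f.
Proof. by apply: fpsP => m; rewrite /fps_euler fps_coefZ [RHS]fps_coefZ mulrnAr. Qed.

Lemma fps_eulerM f g : fps_euler (f * g) = fps_euler f * g + f * fps_euler g.
Proof.
apply: fpsP => m; rewrite fps_coefD {1}/fps_euler !fps_coefM.
rewrite !(fsbig_finite _ _ (finite_mset_split m)) /= -sumrMnl -big_split /=.
rewrite big_seq [RHS]big_seq; apply: eq_bigr => p.
rewrite in_fset_set ?inE /=; last exact: finite_mset_split.
move=> <-; rewrite mset_wtD mulrnDr /fps_euler.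
by rewrite mulrnAl mulrnAr.
Qed.

Lemma fps_euler1 : fps_euler 1 = 0.
Proof.
apply: fpsP => m; rewrite /fps_euler fps_coef1.
by case: eqP => [->|_]; rewrite ?mset_wt0 ?mul0rn.
Qed.

Lemma fps_eulerX f k : fps_euler (f ^+ k.+1) = (k.+1)%:R *: (fps_euler f * f ^+ k).
Proof.
elim: k => [|k IH]; first by rewrite expr1 expr0 mulr1 scale1r.
rewrite exprS fps_eulerM IH -scalerAr mulrCA -exprS.
by rewrite -[X in X + _]scale1r -scalerDl nat1r.
Qed.

Lemma fps_euler_sum (J : Type) (r : seq J) (P : pred J) (F : J -> fps I R) :
  fps_euler (\sum_(j <- r | P j) F j) = \sum_(j <- r | P j) fps_euler (F j).
Proof.
elim/big_rec2: _ => [|j f g _ <-]; last exact: fps_eulerD.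
by apply: fpsP => m; rewrite /fps_euler mul0rn.
Qed.

Definition agree_upto m f g := forall m', m' `<=` m -> f m' = g m'.

(** A coefficient of a product reads its factors only at divisors of the monomial. This is what
    allows truncations in place of infinite series. *)
Lemma agree_coefM m f f' g g' : agree_upto m f f' -> agree_upto m g g' ->
  (f * g) m = (f' * g') m.
Proof.
move=> ff' gg'; rewrite !fps_coefM; apply: eq_fsbigr => -[a b]; rewrite inE /= => eab.
have lea : a `<=` m by apply/msubsetP => i; rewrite -eab msetE2 leq_addr.
have leb : b `<=` m by apply/msubsetP => i; rewrite -eab msetE2 leq_addl.
by rewrite ff' ?gg'.
Qed.

Definition homog d f := forall m, f m != 0 -> mset_wt m = d.

Lemma homog_coef d f m : homog d f -> mset_wt m <> d -> f m = 0.
Proof. by move=> hf ne; apply/eqP; apply: contra_notT ne => /hf. Qed.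

Lemma homogD d f g : homog d f -> homog d g -> homog d (f + g).
Proof.
move=> hf hg m; rewrite fps_coefD.
have [->|/hf //] := eqVneq (f m) 0; by rewrite add0r => /hg.
Qed.

Lemma homog0 d : homog d 0. Proof. by move=> m /eqP. Qed.

Lemma homog_sum d (J : Type) (r : seq J) (P : pred J) (F : J -> fps I R) :
  (forall j, P j -> homog d (F j)) -> homog d (\sum_(j <- r | P j) F j).
Proof. by move=> hF; apply: big_ind => //; [exact: homog0 | exact: homogD]. Qed.

Lemma homogZ d (k : R) f : homog d f -> homog d (k *: f).
Proof.
move=> hf m; rewrite fps_coefZ => nz; apply: hf.
by apply: contraNneq nz => ->; rewrite mulr0.
Qed.

Lemma homogM d e f g : homog d f -> homog e g -> homog (d + e) (f * g).
Proof.
move=> hf hg m; rewrite fps_coefM => nz0.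
(* A nonzero sum has a nonzero summand; [tt] fills the parameter on which the families of [fsbigN1]
   depend. *)
have [[a b] /= <- nz] := @fsbigN1 _ _ _ _ _ _
  (fun (_ : unit) (p : {mset I} * {mset I}) => f p.1 * g p.2) tt nz0.
rewrite mset_wtD.
by rewrite (hf a) ?(hg b) //; apply: contraNneq nz => ->; rewrite ?mulr0 ?mul0r.
Qed.

Lemma homog1 : homog 0 1.
Proof.
by move=> m; rewrite fps_coef1; case: (m =P _) => [-> _|_ /eqP//]; exact: mset_wt0.
Qed.

Lemma homogX d f k : homog d f -> homog (k * d) (f ^+ k).
Proof.
move=> hf; elim: k => [|k IH]; first exact: homog1.
by rewrite exprS mulSn; apply: homogM.
Qed.

Lemma homog_prod (J : Type) (r : seq J) (P : pred J) (d : J -> nat) (F : J -> fps I R) :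
  (forall j, P j -> homog (d j) (F j)) ->
  homog (\sum_(j <- r | P j) d j) (\prod_(j <- r | P j) F j).
Proof.
move=> hF; elim/big_rec2: _ => [|j e f Pj he]; first exact: homog1.
by apply: homogM => //; apply: hF.
Qed.

Lemma homog_var x : homog (wt x) (fps_var R x).
Proof.
move=> m; rewrite /fps_var fps_coef_mon; case: (m =P _) => [-> _|_ /eqP//].
by rewrite -[[mset x]]/(msetn 1 x) mset_wtn mul1n.
Qed.

Lemma fps_euler_homog d f : homog d f -> fps_euler f = d%:R *: f.
Proof.
move=> hf; apply: fpsP => m; rewrite /fps_euler [RHS]fps_coefZ mulr_natl.
by have [->|/hf ->] := eqVneq (f m) 0; rewrite ?mul0rn.
Qed.

Lemma fps_sum_natE (F : nat -> fps I R) N m :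
  (forall n, (N <= n)%N -> F n m = 0) ->
  fps_sum [set: nat] F m = \sum_(n < N) F n m.
Proof.
move=> F0; rewrite /fps_sum (fsbig_ord _ _ (fun n => F n m)).
apply/esym/fsbig_widen => // n [_ /= /negP]; rewrite -leqNgt; exact: F0.
Qed.

Lemma fps_sum_posE (F : nat -> fps I R) N m :
  (forall n, (N < n)%N -> F n m = 0) ->
  fps_sum [set n | (0 < n)%N] F m = \sum_(n < N) F n.+1 m.
Proof.
move=> F0; rewrite /fps_sum -(big_mkord xpredT (fun n => F n.+1 m)).
have <- : \sum_(1 <= n < N.+1) F n m = \sum_(0 <= n < N) F n.+1 m by rewrite big_add1.
rewrite [RHS]fsbig_seq ?iota_uniq //; apply/esym/fsbig_widen.
  by move=> n /=; rewrite mem_index_iota => /andP[].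
move=> n [/= n0 /negP]; rewrite mem_index_iota n0 /= -leqNgt; exact: F0.
Qed.

End Ring.

(** Since [H] has no constant term, the equation at [m] involves [F] and [G] only at smaller
    monomials, and the positive weight of [m] can be cancelled. As [H] may depend on [m], a
    truncation of the true factor is enough. *)
Lemma fps_euler_unique (K : numDomainType) (F G : fps I K) :
  (forall x, (0 < wt x)%N) -> F mset0 = G mset0 ->
  (forall m, exists H : fps I K,
     [/\ H mset0 = 0, fps_euler F m = (H * F) m & fps_euler G m = (H * G) m]) ->
  F = G.
Proof.
move=> wt0 FG0 odes; apply: fpsP => m.
move: {2}(size m) (leqnn (size m)) => s; elim: s m => [|s IH] m.
  by rewrite leqn0 size_mset_eq0 => /eqP ->.
rewrite leq_eqVlt => /orP[/eqP sm|]; last by rewrite ltnS; apply: IH.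
have m0 : m != mset0 by rewrite -size_mset_eq0 sm.
have wm : (0 < mset_wt m)%N.
  rewrite /mset_wt; case: (m : seq _) sm => // x r _.
  by rewrite big_cons addn_gt0 wt0.
have [H [H0 eF eG]] := odes m.
apply: (@mulIf _ (mset_wt m)%:R); first by rewrite pnatr_eq0 -lt0n.
rewrite !mulr_natr -[LHS]/(fps_euler F m) eF -[RHS]/(fps_euler G m) eG !fps_coefM.
apply: eq_fsbigr => -[a b]; rewrite inE /= => eab.
have [->|a0] := eqVneq a mset0; first by rewrite H0 !mul0r.
congr (_ * _); apply: IH; rewrite -ltnS -sm -eab size_msetD.
by rewrite -[X in (X < _)%N]add0n ltn_add2r lt0n size_mset_eq0.
Qed.

Lemma fps_expE (K : fieldType) (f : fps I K) N m : f mset0 = 0 -> (size m < N)%N ->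
  fps_exp f m = \sum_(k < N) ((k`!%:R)^-1 *: f ^+ k) m.
Proof.
move=> f0 sm; apply: fps_sum_natE => n le.
by rewrite fps_coefZ fps_exprS_low ?mulr0 // (leq_trans sm).
Qed.

Lemma fps_exp0 (K : fieldType) (f : fps I K) : f mset0 = 0 -> fps_exp f mset0 = 1.
Proof.
move=> f0; rewrite (@fps_expE _ _ 1) ?size_mset0 // big_ord1 fact0 invr1 scale1r.
by rewrite expr0 fps_coef1 eqxx.
Qed.

Lemma size_msubset m m' : m' `<=` m -> (size m' <= size m)%N.
Proof. by move=> /msetBDK <-; rewrite size_msetD leq_addl. Qed.

Lemma fps_euler_exp (K : numFieldType) (f : fps I K) : f mset0 = 0 ->
  fps_euler (fps_exp f) = fps_euler f * fps_exp f.
Proof.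
move=> f0; apply: fpsP => m.
pose E N : fps I K := \sum_(k < N) ((k`!%:R)^-1 *: f ^+ k).
have EE N : (size m < N)%N -> agree_upto m (fps_exp f) (E N).
  move=> lt m' /size_msubset le; rewrite /E fps_coef_sum; apply: fps_expE => //.
  exact: leq_ltn_trans lt.
(* One term more than needed is kept, because the derivation kills the constant term and shifts the
   others down to [E (size m).+1]. *)
have -> : fps_euler (fps_exp f) m = fps_euler (E (size m).+2) m.
  by rewrite /fps_euler (EE (size m).+2) ?msubset_refl.
rewrite (@agree_coefM _ m _ (fps_euler f) _ (E (size m).+1)) //; last exact: EE.
congr (_ m); rewrite /E big_ord_recl fps_eulerD expr0
  fps_eulerZ fps_euler1 scaler0 add0r.
rewrite fps_euler_sum mulr_sumr; apply: eq_bigr => k _.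
have fE : (k.+1`!%:R)^-1 * k.+1%:R = (k`!%:R)^-1 :> K.
  by rewrite factS natrM invfM mulrAC mulVf ?mul1r // pnatr_eq0.
by rewrite lift0 fps_eulerZ fps_eulerX scalerA -scalerAr fE.
Qed.

End Euler.

(** * Cycle types *)

(** Elements with equal values are matched and removed one at a time. It serves to pair off the
    cycles of two permutations by length. *)
Lemma perm_eq_map_bij (S S' : eqType) (f : S -> nat) (f' : S' -> nat) (d : S') X Y :
    uniq X -> uniq Y -> perm_eq (map f X) (map f' Y) ->
  exists phi : S -> S', [/\ {in X, forall c, phi c \in Y},
    {in X, forall c, f' (phi c) = f c} & {in X &, injective phi}].
Proof.
elim: X Y => [|c X IH] Y; first by exists (fun=> d).
move=> /= /andP[cX uX] uY pXY.
have : f c \in map f' Y by rewrite -(perm_mem pXY) mem_head.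
case/mapP=> e eY fe.
have pY : perm_eq (map f' Y) (f' e :: map f' (rem e Y)).
  by rewrite -map_cons; apply/perm_map/perm_to_rem.
move: pXY => /perm_trans/(_ pY); rewrite fe perm_cons => /(IH _ uX (rem_uniq _ uY)).
case=> phi [phiY phif phi_inj].
have phi_ne c' : c' \in X -> phi c' != e.
  by move=> /phiY; rewrite mem_rem_uniq // inE => /andP[].
exists (fun c' => if c' == c then e else phi c'); split=> [c'|c'|c' c''].
- rewrite inE; case: eqP => //= _ /phiY; exact: mem_rem.
- rewrite inE; case: eqP => [->//|_ /= /phif //].
- rewrite !inE; case: eqP => [->|_]; case: eqP => [->|_] //=.
  + by move=> _ /phi_ne/eqP ne /esym/ne.
  + by move=> /phi_ne/eqP ne _ /ne.
  + exact: phi_inj.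
Qed.

(** The conjugating permutation sends the root of each cycle of [x] to a chosen point [sg] of the
    matching cycle of [y], and then follows both cycles in parallel. *)
Lemma conj_of_cycle_type n (x y : 'S_n) (la : intpartn n) :
  has_cycle_type x la -> has_cycle_type y la -> exists g, y = (x ^ g)%g.
Proof.
rewrite /has_cycle_type => xla; rewrite perm_sym => /(perm_trans xla).
case/(perm_eq_map_bij finset.set0 (enum_uniq _) (enum_uniq _)).
move=> phi [phiY phic phi_inj].
have sym : fingraph.connect_sym (frel x) by apply: fconnect_sym; apply: perm_inj.
have Xp p : porbit x p \in enum (porbits x) by rewrite mem_enum imset_f.
have /fin_all_exists[sg sgE] p : exists q, porbit y q = phi (porbit x p).
  by have := phiY _ (Xp p); rewrite mem_enum => /imsetP[q _ ->]; exists q.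
pose g p := iter (findex x (froot x p) p) y (sg (froot x p)).
have card_sg p : #|porbit y (sg p)| = #|porbit x p| by rewrite sgE phic.
have gE m r : froot x r = r -> g (iter m x r) = iter m y (sg r).
  move=> rr; rewrite /g.
  have -> : froot x (iter m x r) = r.
    by rewrite -[RHS]rr; apply/eqP; rewrite root_connect // sym fconnect_iter.
  have -> : iter m x r = iter (m %% #|porbit x r|) x r.
    by rewrite iter_mod_period ?iter_porbit.
  rewrite findex_iter; last first.
    by rewrite order_porbit ltn_mod lt0n card_porbit_neq0.
  by rewrite iter_mod_period // -card_sg iter_porbit.
have pE p : iter (findex x (froot x p) p) x (froot x p) = p.
  by apply: iter_findex; rewrite sym connect_root.
have rr p : froot x (froot x p) = froot x p by apply: root_root.
have porbit_r p : porbit x (froot x p) = porbit x p.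
  by have := connect_root (frel x) p; rewrite fconnect_porbit -eq_porbit_mem => /eqP.
have gS p : g (x p) = y (g p) by rewrite -{1}(pE p) -iterS gE.
have g_inj : injective g.
  move=> p q gpq.
  have e : porbit x p = porbit x q.
    apply: phi_inj => //; rewrite -(porbit_r p) -(porbit_r q) -!sgE.
    apply/eqP; rewrite -(porbit_perm y (findex x (froot x p) p)).
    rewrite -(porbit_perm y (findex x (froot x q) q) (sg _)) !permX.
    by rewrite -/(g p) gpq.
  have er : froot x p = froot x q.
    by apply/eqP; rewrite root_connect // fconnect_porbit e porbit_id.
  have lt w : (findex x (froot x w) w < #|porbit y (sg (froot x w))|)%N.
    rewrite card_sg -order_porbit; apply: findex_max.
    by rewrite sym connect_root.
  rewrite -(pE p) -(pE q) er; congr iter.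
  apply: (@iter_porbit_inj _ y _ _ (sg (froot x q))); rewrite ?lt //.
    by rewrite -er lt.
  by move: gpq; rewrite /g er.
exists (perm g_inj); apply: (mulgI (perm g_inj)); rewrite -conjgC.
by apply/permP => p; rewrite !permM !permE gS.
Qed.

Section CycleType.
Variable n : nat.
Implicit Types (x y : 'S_n) (la : intpartn n).

Lemma sumn_porbits x : sumn [seq #|c| | c : {set 'I_n} in porbits x] = n.
Proof.
rewrite sumnE big_map big_enum /= -[RHS]card_ord.
transitivity #|finset.cover (porbits x)|; last first.
  apply: eq_card => p; rewrite inE; apply/bigcupP.
  by exists (porbit x p); [apply: imset_f | apply: porbit_id].
apply/eqP; rewrite -/(finset.trivIset (porbits x)).
apply/finset.trivIsetP => _ _ /imsetP[p _ ->] /imsetP[q _ ->]; apply: contraR.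
case/pred0Pn => r /andP[/= rp rq].
by move: rp rq; rewrite -!eq_porbit_mem => /eqP <- /eqP <-.
Qed.

Lemma cycle_type_partn x :
  is_partn n (sort geq [seq #|c| | c : {set 'I_n} in porbits x]).
Proof.
apply/and3P; split.
- by apply: sort_sorted => a b; apply: leq_total.
- rewrite mem_sort; apply/negP => /mapP[c]; rewrite mem_enum => /imsetP[p _ ->].
  by move/esym/eqP; rewrite (negPf (card_porbit_neq0 x p)).
- rewrite sumnE (perm_big _ (permEl (perm_sort _ _))) -sumnE sumn_porbits //.
Qed.

Definition cycle_type x : intpartn n := Partn (cycle_type_partn x).

Lemma has_cycle_typeE x la : has_cycle_type x la = (cycle_type x == la).
Proof.
rewrite /has_cycle_type; apply/idP/eqP => [pla|<-]; last by rewrite perm_sym perm_sort.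
apply: val_inj => /=; apply: (@sorted_eq _ geq).
- by move=> a b c /= ba cb; apply: leq_trans cb ba.
- by move=> a b /andP[/= ab ba]; apply/eqP; rewrite eqn_leq ba.
- by apply: sort_sorted => a b; apply: leq_total.
- by have /and3P[] := partnP la.
- by rewrite perm_sort.
Qed.

Lemma big_porbits (R : Type) (idx : R) (op : Monoid.com_law idx) (F : nat -> R) x :
  \big[op/idx]_(c in porbits x) F #|c| =
  \big[op/idx]_(p | froots x p) F #|porbit x p|.
Proof.
have sym : fingraph.connect_sym (frel x) by apply: fconnect_sym; apply: perm_inj.
have -> : porbits x = [set porbit x p | p in [set p | froots x p]%SET]%SET.
  apply/setP => c; apply/imsetP/imsetP => [[p _ ->]|[p _ ->]]; last by exists p.
  exists (froot x p); first by rewrite inE; apply: roots_root.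
  have := connect_root (frel x) p.
  by rewrite fconnect_porbit -eq_porbit_mem => /eqP.
rewrite big_imset /=; first by apply: eq_bigl => p; rewrite inE.
move=> p q; rewrite !inE => /eqP rp /eqP rq /eqP; rewrite eq_porbit_mem => e.
by rewrite -rp -rq; apply/eqP; rewrite root_connect // sym fconnect_porbit.
Qed.

Lemma big_cycle_type (R : Type) (idx : R) (op : Monoid.com_law idx) (F : nat -> R)
    x la :
  has_cycle_type x la ->
  \big[op/idx]_(j <- la) F j = \big[op/idx]_(p | froots x p) F #|porbit x p|.
Proof.
by move=> xla; rewrite -big_porbits -(perm_big _ xla) /= big_map big_enum.
Qed.

End CycleType.

Section Conjugation.
Variables (n : nat) (x g : 'S_n).

Lemma iter_conj m p : iter m (x ^ g)%g (g p) = g (iter m x p).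
Proof. by elim: m => //= m ->; rewrite permJ. Qed.

Lemma porbit_conj p : porbit (x ^ g)%g (g p) = [set g q | q in porbit x p]%SET.
Proof.
apply/setP => q; apply/porbitP/imsetP => [[m ->]|[r /porbitP[m ->] ->]].
  by exists ((x ^+ m)%g p); rewrite ?mem_porbit // !permX iter_conj.
by exists m; rewrite !permX iter_conj.
Qed.

Lemma card_porbit_conj p : #|porbit (x ^ g)%g (g p)| = #|porbit x p|.
Proof. by rewrite porbit_conj card_imset //; apply: perm_inj. Qed.

(** Conjugation by [g] carries cycles to cycles but not chosen roots to chosen roots, hence the
    [froot] on the right. *)
Lemma reindex_froots (R : Type) (idx : R) (op : Monoid.com_law idx) (F : 'I_n -> R) :
  \big[op/idx]_(p | froots (x ^ g)%g p) F p =
  \big[op/idx]_(p | froots x p) F (froot (x ^ g)%g (g p)).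
Proof.
have sym (z : 'S_n) : fingraph.connect_sym (frel z).
  by apply: fconnect_sym; apply: perm_inj.
pose h p := froot (x ^ g)%g (g p).
have con p q : fconnect (x ^ g)%g (g p) (g q) = fconnect x p q.
  by rewrite !fconnect_porbit porbit_conj mem_imset //; apply: perm_inj.
have -> : \big[op/idx]_(p | froots (x ^ g)%g p) F p =
    \big[op/idx]_(p in [set h p | p in [set p | froots x p]%SET]%SET) F p.
  apply: eq_bigl => q; apply/idP/imsetP => [/eqP rq|[p _ ->]]; last exact: roots_root.
  exists (froot x ((g^-1)%g q)); first by rewrite inE; apply: roots_root.
  rewrite -[LHS]rq; apply/eqP; rewrite root_connect // -{1}(permKV g q) con.
  exact: connect_root.
rewrite big_imset /=; first by apply: eq_bigl => p; rewrite inE.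
move=> p q; rewrite !inE => /eqP rp /eqP rq /eqP; rewrite root_connect // con => e.
by rewrite -rp -rq; apply/eqP; rewrite root_connect.
Qed.

Lemma has_cycle_type_conj la : has_cycle_type (x ^ g)%g la = has_cycle_type x la.
Proof.
suff e : perm_eq [seq #|c| | c : {set 'I_n} in porbits (x ^ g)%g]
    [seq #|c| | c : {set 'I_n} in porbits x].
  by apply/idP/idP; apply: perm_trans; rewrite // perm_sym.
apply/seq.permP => P.
suff H (z : 'S_n) : count P [seq #|c| | c : {set 'I_n} in porbits z] =
    (\sum_(p | froots z p) P #|porbit z p|)%N.
  rewrite !H reindex_froots; apply: eq_bigr => p _.
  by rewrite card_porbit_froot card_porbit_conj.
rewrite -(big_porbits _ (fun j => P j : nat)) -sum1_count big_mkcond big_map.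
rewrite big_enum /=.
by apply: eq_bigr => c _; case: (P _).
Qed.

End Conjugation.

Lemma omega_fun_conj (zeta : prim_roots) n (x y g : 'S_n) : y \in 'C[x]%g ->
  omega_fun zeta (x ^ g)%g (y ^ g)%g = omega_fun zeta x y.
Proof.
move=> yx; have xy : (x * y = y * x)%g by have /cent1P := yx.
have xyg : (x ^ g * y ^ g = y ^ g * x ^ g)%g by rewrite -!conjMg xy.
rewrite -[LHS]/(\prod_(p | froots (x ^ g)%g p) cycle_coef zeta (x ^ g)%g (y ^ g)%g p).
rewrite -[RHS]/(\prod_(p | froots x p) cycle_coef zeta x y p).
rewrite reindex_froots.
(* Along a cycle of x, the labels of p for x and of g p for x ^ g get multiplied by
   the same root of unity, so that their ratio u is constant on the cycles of x;
   y permutes these cycles, so the ratios cancel. *)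
pose u p := cycle_chi zeta (x ^ g)%g (g p) / cycle_chi zeta x p.
have u_neq0 p : u p != 0 by rewrite mulf_neq0 ?invr_eq0 ?cycle_chi_neq0.
have u_root p : u (froot x p) = u p.
  have u_iter m q : u (iter m x q) = u q.
    rewrite /u -iter_conj !cycle_chi_iter card_porbit_conj -mulf_div divff ?mulr1 //.
    exact/expf_neq0/zeta_porbit_neq0.
  by rewrite -[X in u X = _](iter_findex (connect_root (frel x) p)) u_iter.
transitivity (\prod_(p | froots x p) (cycle_coef zeta x y p * (u (y p) / u p))).
  apply: eq_bigr => p rp; rewrite cycle_coef_root // permJ.
  have -> : cycle_coef zeta x y p = cycle_chi zeta x (y p) / cycle_chi zeta x p.
    by rewrite -cycle_coef_root // (eqP rp).
  by rewrite /u; field; rewrite !cycle_chi_neq0.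
rewrite big_split /= prodf_div.
have <- : \prod_(p | froots x p) u p = \prod_(p | froots x p) u (y p).
  have xyx : (x ^ y)%g = x by rewrite conjgE xy mulKg.
  have := @reindex_froots n x y algC 1 _ u; rewrite xyx => ->.
  by apply: eq_bigr => p _; rewrite u_root.
by rewrite divff ?mulr1 //; apply/prodf_neq0.
Qed.

Lemma big_count (R : Type) (idx : R) (op : Monoid.com_law idx) (F : nat -> R) N s :
  all (fun j => (0 < j <= N)%N) s ->
  \big[op/idx]_(j <- s) F j =
  \big[op/idx]_(1 <= j < N.+1) iter (count_mem j s) (op (F j)) idx.
Proof.
elim: s => [_|x s IH /= /andP[xN /IH IHs]]; first by rewrite big_nil big1.
rewrite big_cons IHs.
transitivity (\big[op/idx]_(1 <= j < N.+1)
    op (if j == x then F j else idx) (iter (count_mem j s) (op (F j)) idx)); last first.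
  by apply: eq_bigr => j _; rewrite eq_sym; case: eqP; rewrite ?Monoid.mul1m.
rewrite big_split -big_mkcond; congr (op _ _).
rewrite -big_filter filter_pred1_uniq ?big_seq1 ?iota_uniq // mem_index_iota.
by rewrite ltnS.
Qed.

(** * The cycle index of the symmetric group and the sizes of conjugacy classes *)

Section CycleIndex.
Variables (zeta : prim_roots) (R : comAlgType algC) (t : nat -> R).

Definition cycle_weight n (y : 'S_n) : R := \prod_(p | froots y p) t #|porbit y p|.

(* This specialization kills all pairs whose first permutation is not 1. *)
Let s1 (i : nat) : R := (i == 1%N)%:R.

Lemma comm_pairT n (z : 'S_n * 'S_n) :
  comm_pair finset.setT z = (z.1 * z.2 == z.2 * z.1)%g.
Proof.
have pT (x : 'S_n) : perm_on finset.setT x by apply/fintype.subsetP => p _; rewrite inE.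
by rewrite /comm_pair !pT.
Qed.

(** A permutation other than 1 has a cycle of length above 1, where [s1] vanishes. For the identity,
    the only root of unity involved is [zeta 1], which is 1. *)
Lemma comm_series_cycle_index n :
  comm_series zeta s1 t n = (n`!%:R)^-1 *: \sum_(y : 'S_n) cycle_weight y.
Proof.
congr (_ *: _); rewrite /comm_sum.
rewrite -(pair_big_dep xpredT (fun x y => comm_pair finset.setT (x, y))
   (fun x y => pair_weight zeta s1 t finset.setT (x, y))) /=.
have W x y : pair_weight zeta s1 t finset.setT (x, y) =
    (\prod_(p | froots x p) (cycle_coef zeta x y p *: s1 #|porbit x p|)) *
    cycle_weight y.
  by congr (_ * _); apply: eq_bigl => p; rewrite inE.
rewrite (bigD1 1%g) //= [X in _ + X]big1 ?addr0 => [|x x1]; last first.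
  apply: big1 => y _; rewrite W.
  have [p xp] : exists p, x p != p.
    by apply/existsP; apply: contraNT x1; rewrite negb_exists => /forallP h;
      apply/eqP/permP => p; rewrite perm1; apply/eqP; have := h p; rewrite negbK.
  rewrite (bigD1 (froot x p)) /=; last first.
    by apply: roots_root; apply: fconnect_sym; apply: perm_inj.
  rewrite card_porbit_froot /s1; case: eqP => [o1|_]; last by rewrite scaler0 !mul0r.
  by move: xp; have := iter_porbit x p; rewrite o1 /= => ->; rewrite eqxx.
apply: eq_big => [y|y _]; first by rewrite comm_pairT /= mul1g mulg1 eqxx.
rewrite W big1 ?mul1r // => p _.
have o1 : #|porbit 1%g p| = 1%N.
  apply: card_porbit_dvd => // l; rewrite dvd1n -permX expg1n perm1; exact: eqxx.
rewrite /cycle_coef o1 /s1 eqxx.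
have := prim_expr_order (prim_rootsP zeta (ltn0Sn 0)); rewrite expr1 => ->.
by rewrite expr1n scale1r.
Qed.

Lemma cycle_index_rec n :
  n%:R * comm_series zeta s1 t n =
  \sum_(a < n) t a.+1 * comm_series zeta s1 t (n - a.+1).
Proof.
case: n => [|n]; first by rewrite big_ord0 mul0r.
rewrite comm_series_rec big_ord_recl /= [X in _ + X]big1 ?addr0 => [|i _]; last first.
  apply: big1 => a _; rewrite big1 ?mul0r // => k _.
  by rewrite /grid_term /s1 /= expr0n mul0r scaler0.
apply: eq_big => [a|a _]; first by rewrite muln1 ltn_ord.
rewrite big_ord1 muln1 /grid_term gcdn0 divnn /= muln1 expr0 scale1r.
by rewrite /s1 eqxx expr1n mul1r expr1.
Qed.

End CycleIndex.

Section ClassSize.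
Local Open Scope mset_scope.
Variable zeta : prim_roots.
Local Notation T := (fps nat algC).
Local Notation q := (comm_series zeta (fun i => (i == 1%N)%:R : T) (fps_var algC)).

Lemma fps_coef_varM (I : choiceType) (R : comNzRingType) x (f : fps I R) m :
  (fps_var R x * f) m = if x \in m then f (m `\ x) else 0.
Proof.
rewrite fps_coefM /fps_var; case: ifP => xm.
  rewrite (fsbigD1 ([mset x], m `\ x)) /=; first last.
  - exact: msetB1K.
  - exact: finite_mset_split.
  rewrite fps_coef_mon eqxx mul1r fsbig1 ?addr0 // => -[a b] /= [eab nab].
  rewrite fps_coef_mon; case: eqP => [ea|_]; last by rewrite mul0r.
  by case: nab; rewrite -eab ea msetD1K.
apply: fsbig1 => -[a b] /= eab; rewrite fps_coef_mon; case: eqP => [ea|_].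
  by move: xm; rewrite -eab ea in_msetD in_mset1 eqxx.
by rewrite mul0r.
Qed.

(** The centralizer order of a cycle type given as a multiset; the bound [N] stays fixed while the
    induction removes parts. *)
Let zc N (m : {mset nat}) : nat := \prod_(1 <= j < N.+1) ((m j)`! * j ^ m j)%N.

Let zcB N (m : {mset nat}) j : j \in m -> (0 < j <= N)%N ->
  zc N m = (m j * j * zc N (m `\ j))%N.
Proof.
move=> jm jN; have jr : j \in index_iota 1 N.+1 by rewrite mem_index_iota ltnS.
rewrite /zc !(bigD1_seq j) ?iota_uniq //= msetB1E eqxx subn1 !mulnA; congr (_ * _)%N.
  case: (m j) (mset_gt0 j m) => [|k _]; first by rewrite jm.
  by rewrite factS expnS /=; lia.
by apply: eq_bigr => l /negPf lj; rewrite msetB1E lj subn0.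
Qed.

(** Removing a part [j] divides [zc] by [m j * j], so the recursion comes down to the parts, with
    multiplicity, adding up to [n]. *)
Lemma cycle_index_coef N n (m : {mset nat}) : (n <= N)%N -> 0%N \notin m ->
  mset_wt id m = n -> q n m = (zc N m)%:R^-1.
Proof.
elim/ltn_ind: n m => n IH m nN m0 wm.
have [n0|n_gt0] := posnP n.
  have -> : m = mset0.
    case: (mset_0Vmem m) => // -[x xm]; move: wm; rewrite n0 /mset_wt => /eqP.
    rewrite sum_nat_seq_eq0 => /allP/(_ x xm)/eqP x0.
    by move: m0; rewrite -x0 xm.
  rewrite n0 comm_series0 fps_coef1 eqxx /zc big1 ?invr1 // => j _.
  by rewrite mset0E.
have ineq : all (fun j => (0 < j <= n)%N) (m : seq nat).
  apply/allP => j jm; apply/andP; split.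
    by rewrite lt0n; apply: contraNneq m0 => <-.
  by rewrite -wm /mset_wt (perm_big _ (perm_to_rem jm)) big_cons leq_addr.
have n_neq0 : n%:R != 0 :> algC by rewrite pnatr_eq0 -lt0n.
apply: (mulfI n_neq0).
have -> : n%:R * q n m = (n%:R * q n) m.
  by rewrite [in RHS]mulr_natl -[RHS]/((q n *+ n) m) -scaler_nat.
rewrite cycle_index_rec fps_coef_sum.
transitivity (\sum_(a < n) ((m a.+1 * a.+1)%N%:R / (zc N m)%:R : algC)).
  apply: eq_bigr => a _; rewrite fps_coef_varM; case: ifP => am; last first.
    by rewrite -[m a.+1]/(m a.+1) (mset_eq0P (negbT am)) mul0n mul0r.
  have aN : (0 < a.+1 <= N)%N by rewrite /= (leq_trans (ltn_ord a)).
  rewrite (zcB am aN) (natrM _ (m a.+1 * a.+1)) invfM mulrA mulfV ?mul1r; last first.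
    by rewrite pnatr_eq0 muln_eq0 orbF mset_eq0 am.
  apply: IH; first by have := ltn_ord a; lia.
  - by have := ltn_ord a; lia.
  - by rewrite in_msetB1 (negPf m0) andbF.
  - apply: (@addnI a.+1); rewrite subnKC // -[RHS]wm -[in RHS](msetB1K am) mset_wtD.
    by congr (_ + _)%N; rewrite -[[mset _]]/(msetn 1 _) mset_wtn mul1n.
rewrite -mulr_suml -natr_sum; congr (_%:R / _).
rewrite -[RHS]wm /mset_wt (big_count _ _ ineq) big_add1 /= big_mkord.
apply: eq_bigr => a _; rewrite count_mem_mset.
by rewrite iter_addn_0 mulnC.
Qed.

Lemma fps_prod_var (I : choiceType) (R : comNzRingType) (s : seq I) :
  \prod_(j <- s) fps_var R j = fps_mon R (seq_mset s).
Proof.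
elim: s => [|x s IH]; last by rewrite big_cons IH /fps_var fps_monM -mset_cons.
rewrite big_nil -fps_mon0; congr (@fps_mon I R _).
by apply/msetP => i; rewrite mset_seqE mset0E.
Qed.

(** With one indeterminate for each cycle length, the monomial of a permutation records its cycle
    type, so the class size is n! times a coefficient of the cycle index. *)
Lemma card_cycle_type n (nu : intpartn n) :
  #|[pred y : 'S_n | has_cycle_type y nu]|%:R = n`!%:R / (zcard nu)%:R :> algC.
Proof.
have f0 : n`!%:R != 0 :> algC by rewrite pnatr_eq0 -lt0n fact_gt0.
have -> : zcard nu = zc n (seq_mset nu).
  by apply: eq_bigr => j _; rewrite mset_seqE.
have /and3P[_ nu0 /eqP nun] := partnP nu.
rewrite -(@cycle_index_coef n n) //; first last.
- rewrite /mset_wt (perm_big _ (perm_eq_seq_mset nu)) /=.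
  by rewrite -[RHS]nun sumnE.
- by rewrite (perm_mem (perm_eq_seq_mset nu)).
rewrite comm_series_cycle_index fps_coefZ mulrA divff // mul1r fps_coef_sum.
rewrite -sumr_const big_mkcond; apply: eq_bigr => y _.
have e : has_cycle_type y (cycle_type y) by rewrite has_cycle_typeE.
rewrite /cycle_weight -(big_cycle_type _ _ e) fps_prod_var fps_coef_mon inE.
rewrite has_cycle_typeE.
have -> : (seq_mset nu == seq_mset (cycle_type y)) = (cycle_type y == nu).
  apply/eqP/eqP => [/eq_seq_msetP p|-> //]; apply/eqP; rewrite -has_cycle_typeE.
  by rewrite /has_cycle_type; apply: perm_trans e _; rewrite perm_sym.
by case: eqP.
Qed.

End ClassSize.

(** * The generating function *)

Section LieSide.
Variable zeta : prim_roots.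

Definition signed_t (j : nat) : fps_st := (-1) ^+ j.-1 *: t_ j.

(** [odd_perm] is the parity of n plus the number of cycles, and the numbers [#|c|.-1] add up to n
    minus the number of cycles. *)
Lemma sign_porbits n (x : 'S_n) :
  (-1) ^+ x = \prod_(c in porbits x) (-1) ^+ #|c|.-1 :> algC.
Proof.
rewrite -expr_sum; have e : (\sum_(c in porbits x) #|c|.-1 + #|porbits x| = n)%N.
  rewrite -sum1_card -big_split /=.
  rewrite -[RHS](sumn_porbits x) sumnE big_map big_enum /=.
  apply: eq_bigr => c /imsetP[p _ ->]; rewrite addn1 prednK //.
  by rewrite lt0n card_porbit_neq0.
by rewrite /odd_perm card_ord -(congr1 odd e) oddD addbK signr_odd.
Qed.

Lemma prod_part_mult n (la : intpartn n) (R : comNzRingType) (F : nat -> R) :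
  \prod_(j <- la) F j = \prod_(1 <= j < n.+1) F j ^+ part_mult la j.
Proof.
rewrite (big_count _ _ (mem_partn_le (partnP la))); apply: eq_bigr => j _.
by rewrite iter_mulr_1.
Qed.

Lemma cycle_weight_t n (y : 'S_n) (nu : intpartn n) : has_cycle_type y nu ->
  cycle_weight signed_t y = sign_partn nu *: t_mon nu.
Proof.
move=> ynu; rewrite /cycle_weight scaler_prod; congr (_ *: _).
  have := sign_porbits (perm_of_partn nu); rewrite /sign_partn => ->.
  rewrite (big_porbits _ (fun k => (-1) ^+ k.-1)).
  rewrite -(big_cycle_type _ (fun k => (-1) ^+ k.-1) (perm_of_partnP nu)).
  by rewrite -(big_cycle_type _ (fun k => (-1) ^+ k.-1) ynu).
by rewrite -(big_cycle_type _ _ ynu) prod_part_mult.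
Qed.

Lemma cycle_weight_conj n (R : comAlgType algC) (t : nat -> R) (y g : 'S_n) :
  cycle_weight t (y ^ g)%g = cycle_weight t y.
Proof.
rewrite /cycle_weight reindex_froots; apply: eq_bigr => p _.
by rewrite card_porbit_froot card_porbit_conj.
Qed.

Section Fixed.
Variables (n : nat) (la : intpartn n).
Let X := perm_of_partn la.

Definition cent_sum (x : 'S_n) : fps_st :=
  \sum_(y in 'C[x]%g) omega_fun zeta x y *: cycle_weight signed_t y.

Lemma cent_sum_conj (x g : 'S_n) : cent_sum (x ^ g)%g = cent_sum x.
Proof.
rewrite /cent_sum (reindex_inj (conjg_inj g)).
apply: eq_big => [y|y]; first by rewrite cent1J memJ_conjg.
by rewrite cent1J memJ_conjg => yx; rewrite omega_fun_conj // cycle_weight_conj.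
Qed.

Lemma type_class : [set x | has_cycle_type x la]%SET = (X ^: finset.setT)%g.
Proof.
apply/setP => x; rewrite inE; apply/idP/imsetP => [xla|[g _ ->]].
  by have [g ->] := conj_of_cycle_type (perm_of_partnP la) xla; exists g; rewrite ?inE.
by rewrite has_cycle_type_conj perm_of_partnP.
Qed.

Lemma card_type_class :
  (#|[pred x | has_cycle_type x la]| * #|'C[X]%g| = n`!)%N.
Proof.
have -> : #|[pred x | has_cycle_type x la]| = #|(X ^: finset.setT)%g|.
  by rewrite -type_class; apply: eq_card => x; rewrite !inE.
have -> : n`! = #|[set: 'S_n]%SET| by rewrite cardsT card_Sn.
by rewrite -index_cent1 finset.setTI mulnC Lagrange ?finset.subsetT.
Qed.

(** The induced character at [y] is an average of [omega] over the conjugates of [y]. As the cycle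
    weight is a class function, each of the n! conjugations contributes [cent_sum X], and n! over
    the order of the centralizer is the number of [x] on the right, all with the same [cent_sum]. *)
Lemma higher_lie_sum :
  \sum_y higher_lie zeta la y *: cycle_weight signed_t y =
  \sum_(x | has_cycle_type x la) cent_sum x.
Proof.
have c0 : #|'C[X]%g|%:R != 0 :> algC by rewrite pnatr_eq0 -lt0n cardG_gt0.
have -> : \sum_(x | has_cycle_type x la) cent_sum x =
    #|[pred x | has_cycle_type x la]|%:R *: cent_sum X.
  rewrite scaler_nat -sumr_const; apply: eq_big => [x|x]; first by rewrite inE.
  by case/(conj_of_cycle_type (perm_of_partnP la)) => g ->; rewrite cent_sum_conj.
have -> : #|[pred x | has_cycle_type x la]|%:R = n`!%:R / #|'C[X]%g|%:R :> algC.
  by rewrite -card_type_class natrM mulfK.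
have E (g : 'S_n) :
    \sum_y omega zeta X (y ^ g)%g *: cycle_weight signed_t y = cent_sum X.
  rewrite /cent_sum [RHS]big_mkcond (reindex_inj (conjg_inj (g^-1)%g)) /=.
  apply: eq_bigr => y _; rewrite conjgKV cycle_weight_conj.
  by rewrite cfunE; case: ifP; rewrite ?scale0r.
transitivity (\sum_y \sum_(g : 'S_n) (#|'C[X]%g|%:R^-1 : algC) *:
    (omega zeta X (y ^ g)%g *: cycle_weight signed_t y)).
  apply: eq_bigr => y _; rewrite /higher_lie cfIndE ?finset.subsetT //.
  rewrite -scaler_sumr -scaler_suml scalerA; congr (_ * _ *: _).
  by apply: eq_bigl => g; rewrite inE.
rewrite exchange_big /=.
under eq_bigr => g _ do rewrite -scaler_sumr E.
by rewrite sumr_const card_Sn -scaler_nat scalerA.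
Qed.

End Fixed.

(** The class size n! / z_nu turns the sum over [nu] into a sum over permutations [y];
    [higher_lie_sum] then turns the sum over [la] into one over the pairs [(x, y)]. *)
Lemma lie_side_term n :
  \sum_(la : intpartn n) \sum_(nu : intpartn n)
    (sign_partn nu * higher_lie zeta la (perm_of_partn nu) / (zcard nu)%:R)
      *: (s_mon la * t_mon nu) =
  comm_series zeta s_ signed_t n.
Proof.
have f0 : n`!%:R != 0 :> algC by rewrite pnatr_eq0 -lt0n fact_gt0.
rewrite /comm_series /comm_sum.
rewrite -(pair_big_dep xpredT (fun x y => comm_pair finset.setT (x, y))
   (fun x y => pair_weight zeta s_ signed_t finset.setT (x, y))) /=.
rewrite (partition_big (@cycle_type n) xpredT) //= scaler_sumr.
apply: eq_bigr => la _.
transitivity ((n`!%:R)^-1 *: (s_mon la *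
    \sum_y higher_lie zeta la y *: cycle_weight signed_t y)).
  rewrite (partition_big (@cycle_type n) xpredT) //= mulr_sumr scaler_sumr.
  apply: eq_bigr => nu _.
  transitivity ((n`!%:R)^-1 *: (s_mon la *
     (#|[pred y : 'S_n | has_cycle_type y nu]|%:R *:
      (higher_lie zeta la (perm_of_partn nu) *: (sign_partn nu *: t_mon nu))))).
    rewrite (card_cycle_type zeta) -!scalerAr !scalerA; congr (_ *: _).
    by rewrite !mulrA mulVf // mul1r [LHS]mulrC [sign_partn nu * _]mulrC mulrA.
  congr (_ *: (_ * _)); rewrite scaler_nat -sumr_const.
  apply: eq_big => [y|y]; first by rewrite inE has_cycle_typeE.
  rewrite inE => ynu; rewrite (cycle_weight_t ynu).
  have [g ->] := conj_of_cycle_type (perm_of_partnP nu) ynu.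
  by rewrite cfunJ ?inE.
congr (_ *: _); rewrite higher_lie_sum mulr_sumr.
apply: eq_big => [x|x xla]; first by rewrite has_cycle_typeE.
rewrite /cent_sum mulr_sumr; apply: eq_big => [y|y _].
  by rewrite comm_pairT /=; apply/cent1P/eqP.
rewrite /pair_weight /=.
have -> : s_mon la = \prod_(p | froots x p) s_ #|porbit x p|.
  by rewrite -(big_cycle_type _ _ xla) prod_part_mult.
rewrite -/(cycle_weight signed_t y) -scalerAr.
have inT (F : 'I_n -> fps_st) z :
    \prod_(p in finset.setT | froots z p) F p = \prod_(p | froots z p) F p.
  by apply: eq_bigl => p; rewrite inE.
by rewrite !inT scaler_prod -scalerAl.
Qed.

End LieSide.

(* Only positivity matters for s_0 and t_0, which do not occur. *)
Definition st_wt (x : nat + nat) : nat :=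
  let k := match x with inl i => i | inr j => j end in maxn k 1.

Lemma st_wt_gt0 x : (0 < st_wt x)%N.
Proof. by rewrite /st_wt leq_maxr. Qed.

Lemma sum_part_mult n (la : intpartn n) :
  (\sum_(1 <= j < n.+1) part_mult la j * j = n)%N.
Proof.
have /and3P[_ _ /eqP ln] := partnP la; rewrite -[RHS]ln sumnE.
rewrite (big_count _ _ (mem_partn_le (partnP la))); apply: eq_bigr => j _.
by rewrite iter_addn_0 mulnC.
Qed.

Local Notation wt := (mset_wt st_wt).

Lemma homog_s i : (0 < i)%N -> homog st_wt i (s_ i).
Proof.
by move=> i0; have := @homog_var _ st_wt algC (inl i); rewrite /st_wt (maxn_idPl i0).
Qed.

Lemma homog_t j : (0 < j)%N -> homog st_wt j (t_ j).
Proof.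
by move=> j0; have := @homog_var _ st_wt algC (inr j); rewrite /st_wt (maxn_idPl j0).
Qed.

Lemma homog_mon (v : nat -> fps_st) n (la : intpartn n) :
  (forall i, (0 < i)%N -> homog st_wt i (v i)) ->
  homog st_wt n (\prod_(1 <= j < n.+1) v j ^+ part_mult la j).
Proof.
move=> hv; rewrite -[X in homog _ X](sum_part_mult la).
rewrite big_seq [X in homog _ _ X]big_seq.
apply: homog_prod => j; rewrite mem_index_iota => /andP[j0 _].
exact/homogX/hv.
Qed.

(** The term of the exponent at (i, j, e), rewritten with j = a e and with its denominator i j / e
    cleared. *)
Definition log_monomial (i a e : nat) : fps_st :=
  ((-1) ^+ (i %/ e * (a * e).-1) * (mobius e)%:~R)
    *: (s_ i ^+ a * t_ (a * e)%N ^+ (i %/ e)).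

Lemma homog_log_monomial i a e : (0 < i)%N -> (0 < a)%N -> (e %| i)%N ->
  homog st_wt (2 * (i * a)) (log_monomial i a e).
Proof.
move=> i0 a0 ei; have e0 := dvdn_gt0 i0 ei.
have -> : (2 * (i * a) = a * i + i %/ e * (a * e))%N.
  by rewrite [(i %/ e * _)%N]mulnCA divnK //; lia.
apply: homogZ; apply: homogM; apply: homogX; first exact: homog_s.
by apply: homog_t; rewrite muln_gt0 a0.
Qed.

(** * Comparison of the two sides through truncated Euler equations *)

Section Final.
Variable zeta : prim_roots.
Local Notation p := (comm_series zeta s_ signed_t).
Local Notation g i a := (\sum_(k < i.+1) grid_term zeta s_ signed_t i a k).

Lemma homog_series n : homog st_wt (2 * n) (p n).
Proof.
rewrite -lie_side_term mul2n -addnn; apply: homog_sum => la _; apply: homog_sum => nu _.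
by apply: homogZ; apply: homogM; apply: homog_mon; [exact: homog_s | exact: homog_t].
Qed.

Lemma grid_sum_log i a :
  g i a = \sum_(e <- divisors i.+1) log_monomial i.+1 a.+1 e.
Proof.
pose G e : fps_st := s_ i.+1 ^+ a.+1 * signed_t (a.+1 * e)%N ^+ (i.+1 %/ e).
transitivity (\sum_(k < i.+1) zeta i.+1 ^+ k *: G (i.+1 %/ gcdn i.+1 k)%N).
  apply: eq_bigr => k _; rewrite /grid_term /G; congr (_ *: (_ * _ ^+ _)).
  by rewrite divnA ?dvdn_gcdl // mulKn.
rewrite (sum_root_gcd G (ltn0Sn i) (prim_rootsP zeta (ltn0Sn i))).
apply: eq_bigr => e _; rewrite /G /log_monomial /signed_t exprZn -exprM.
by rewrite -scalerAr scalerA mulrC [(_.-1 * _)%N]mulnC.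
Qed.

Lemma homog_grid_sum i a : homog st_wt (2 * (i.+1 * a.+1)) (g i a).
Proof.
rewrite grid_sum_log big_seq; apply: homog_sum => e.
by rewrite -dvdn_divisors // => ei; apply: homog_log_monomial.
Qed.

Lemma sum_shift (V : zmodType) (u : nat -> V) N b :
  \sum_(n < N | (b <= n)%N) u (n - b)%N = \sum_(n < N | (n + b < N)%N) u n.
Proof.
have -> : \sum_(n < N | (n + b < N)%N) u n = \sum_(0 <= n < N - b) u n.
  rewrite (big_nat_widen _ _ N) ?leq_subr // big_mkord.
  by apply: eq_bigl => n; rewrite ltn_subRL addnC.
have -> : \sum_(0 <= n < N - b) u n = \sum_(0 + b <= n < N) u (n - b)%N.
  by rewrite big_addn; apply: eq_bigr => n _; rewrite addnK.
rewrite add0n -(big_mkord (fun n => b <= n)%N (fun n => u (n - b)%N)).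
by rewrite [RHS](big_nat_widenl _ 0) //; apply: eq_bigl => n; rewrite andbT.
Qed.

(** This is [comm_series_rec], doubled because [p n] has weight 2 n. The product of truncations
    contains further terms, with n + (a + 1) (i + 1) > N, but their weight exceeds 2 N and they do
    not reach [m]. *)
Lemma euler_series N m : (wt m <= 2 * N)%N ->
  fps_euler st_wt (\sum_(n < N.+1) p n) m =
  (2%:R *: (\sum_(i < N) \sum_(a < N) g i a) * \sum_(n < N.+1) p n) m.
Proof.
move=> mN; rewrite fps_euler_sum.
have -> : \sum_(n < N.+1) fps_euler st_wt (p n) =
    2%:R *: \sum_(n < N.+1) n%:R * p n.
  rewrite scaler_sumr; apply: eq_bigr => n _.
  rewrite (fps_euler_homog (@homog_series n)) natrM -scalerA.
  by congr (_ *: _); rewrite mulr_natl scaler_nat.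
have -> : \sum_(n < N.+1) n%:R * p n = \sum_(i < N) \sum_(a < N)
    g i a * \sum_(n < N.+1 | (n + a.+1 * i.+1 < N.+1)%N) p n.
  transitivity (\sum_(n < N.+1) \sum_(i < N) \sum_(a < N)
      (if (a.+1 * i.+1 <= n)%N then g i a * p (n - a.+1 * i.+1)%N else 0)).
    apply: eq_bigr => n _; rewrite comm_series_rec.
    have nN : (n <= N)%N by rewrite -ltnS.
    rewrite (big_ord_widen _ (fun i => \sum_(a < n | (a.+1 * i.+1 <= n)%N)
       g i a * p (n - a.+1 * i.+1)%N) nN) big_mkcond /=.
    apply: eq_bigr => i _.
    rewrite (big_ord_widen_cond _ (fun a => (a.+1 * i.+1 <= n)%N)
      (fun a => g i a * p (n - a.+1 * i.+1)%N) nN) big_mkcond /=.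
    case: ltnP => iN; first last.
      rewrite big1 // => a _; rewrite ifF //; apply/negbTE; rewrite -ltnNge.
      by apply: leq_trans (leq_pmull _ _).
    apply: eq_bigr => a _; case: (leqP (a.+1 * i.+1) n) => //= le.
    by rewrite ifT //; apply: leq_trans le; apply: leq_pmulr.
  rewrite exchange_big /=; apply: eq_bigr => i _.
  rewrite exchange_big /=; apply: eq_bigr => a _.
  by rewrite -big_mkcond -mulr_sumr sum_shift.
rewrite -scalerAl !fps_coefZ; congr (_ * _).
rewrite mulr_suml !fps_coef_sum; apply: eq_bigr => i _.
rewrite mulr_suml !fps_coef_sum; apply: eq_bigr => a _.
rewrite !mulr_sumr !fps_coef_sum.
rewrite [RHS](bigID (fun n : 'I__ => (n + a.+1 * i.+1 < N.+1)%N)) /=.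
rewrite [X in _ = _ + X]big1 ?addr0 // => n; rewrite -leqNgt => lt.
apply: homog_coef (homogM (@homog_grid_sum i a) (@homog_series n)) _.
by move=> e; move: mN; rewrite e; lia.
Qed.

Lemma divisors_gcd i j : (0 < i)%N -> (0 < j)%N ->
  perm_eq (divisors (gcdn i j)) [seq e <- divisors i | (e %| j)%N].
Proof.
move=> i0 j0; apply: uniq_perm; rewrite ?filter_uniq ?divisors_uniq // => e.
by rewrite mem_filter -!dvdn_divisors ?gcdn_gt0 ?i0 // dvdn_gcd andbC.
Qed.

Lemma sum_multiples (V : zmodType) (u : nat -> V) N e : (0 < e)%N ->
  \sum_(j < N | (e %| j.+1)%N) u (j.+1 %/ e)%N =
  \sum_(a < N | (a.+1 * e <= N)%N) u a.+1.
Proof.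
move=> e0.
have shift (P : pred nat) (F : nat -> V) :
    \sum_(j < N | P j.+1) F j.+1 = \sum_(1 <= j < N.+1 | P j) F j.
  by rewrite big_add1 big_mkord.
rewrite (shift (fun j => e %| j)%N (fun j => u (j %/ e)%N)).
rewrite (shift (fun a => a * e <= N)%N u) -big_filter -[RHS]big_filter.
rewrite -(big_map (fun j => j %/ e)%N xpredT u); apply: perm_big; apply: uniq_perm.
- rewrite map_inj_in_uniq ?filter_uniq ?iota_uniq // => j k.
  rewrite !mem_filter => /andP[ej _] /andP[ek _] eq.
  by rewrite -(divnK ej) -(divnK ek) eq.
- by rewrite filter_uniq // iota_uniq.
move=> a; rewrite mem_filter mem_index_iota; apply/mapP/andP => [[j]|[aN /andP[a0 _]]].
  rewrite mem_filter mem_index_iota => /and3P[ej j0 jN] ->.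
  have q0 : (0 < j %/ e)%N by rewrite divn_gt0 // dvdn_leq.
  by rewrite divnK // q0 (leq_ltn_trans (leq_div j e) jN).
exists (a * e)%N; last by rewrite mulnK.
by rewrite mem_filter mem_index_iota dvdn_mull // muln_gt0 a0 e0 ltnS.
Qed.

(** The monomial at [e] has weight 2 i j / e, half from s and half from t, which cancels the
    denominator and leaves the factor 2. *)
Lemma euler_log_term i j : (0 < i)%N -> (0 < j)%N ->
  fps_euler st_wt (log_term i j) =
  2%:R *: \sum_(e <- divisors i | (e %| j)%N) log_monomial i (j %/ e) e.
Proof.
move=> i0 j0; rewrite /log_term (perm_big _ (divisors_gcd i0 j0)) big_filter.
rewrite fps_euler_sum scaler_sumr big_seq_cond [RHS]big_seq_cond.
apply: eq_bigr => e /andP[]; rewrite -dvdn_divisors // => ei ej.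
have e0 := dvdn_gt0 i0 ei.
have q0 : (0 < j %/ e)%N by rewrite divn_gt0 // dvdn_leq.
have hm : homog st_wt (2 * (i * (j %/ e))) (s_ i ^+ (j %/ e) * t_ j ^+ (i %/ e)).
  have -> : (2 * (i * (j %/ e)) = j %/ e * i + i %/ e * j)%N.
    have -> : (i %/ e * j = j %/ e * i)%N by rewrite -{1}(divnK ej) mulnCA divnK.
    by lia.
  by apply: homogM; apply: homogX; [exact: homog_s | exact: homog_t].
rewrite fps_eulerZ (fps_euler_homog hm) /log_monomial divnK // !scalerA.
congr (_ *: _); rewrite -muln_divA // (natrM _ 2) [2%:R * _%:R]mulrC mulrA divfK.
  exact: mulrC.
by rewrite pnatr_eq0 -lt0n muln_gt0 i0.
Qed.

Lemma euler_log N m : (wt m <= 2 * N)%N ->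
  fps_euler st_wt (\sum_(i < N) \sum_(j < N) log_term i.+1 j.+1) m =
  (2%:R *: (\sum_(i < N) \sum_(a < N) g i a)) m.
Proof.
move=> mN; rewrite fps_euler_sum scaler_sumr !fps_coef_sum; apply: eq_bigr => i _.
rewrite fps_euler_sum.
under eq_bigr => j _ do rewrite euler_log_term //.
rewrite -!scaler_sumr !fps_coefZ; congr (_ * _).
rewrite (exchange_big_dep xpredT) //=.
under [in RHS]eq_bigr => a _ do rewrite grid_sum_log.
rewrite [in RHS]exchange_big /= !fps_coef_sum.
rewrite big_seq [RHS]big_seq; apply: eq_bigr => e.
rewrite -dvdn_divisors // => ei.
have e0 := dvdn_gt0 (ltn0Sn i) ei.
rewrite (sum_multiples (fun a => log_monomial i.+1 a e) N e0) !fps_coef_sum.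
(* The cutoffs differ: j <= N leaves only the [a] with (a + 1) e <= N. The other terms on the right
   have weight above 2 N, because [e] divides [i.+1] and is therefore at most [i.+1]. *)
rewrite [RHS](bigID (fun a : 'I_N => (a.+1 * e <= N)%N)) /=.
rewrite [X in _ = _ + X]big1 ?addr0 // => a; rewrite -ltnNge => lt.
apply: homog_coef (homog_log_monomial (ltn0Sn i) (ltn0Sn a) ei) _.
have : (a.+1 * e <= i.+1 * a.+1)%N by rewrite mulnC leq_mul2r dvdn_leq ?orbT.
by move=> le e2; move: mN; rewrite e2; lia.
Qed.

Lemma mset_wt_mem (x : nat + nat) (m : {mset nat + nat}%mset) :
  x \in m -> (st_wt x <= wt m)%N.
Proof.
by move=> xm; rewrite /mset_wt (perm_big _ (perm_to_rem xm)) big_cons leq_addr.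
Qed.

Lemma log_term_coef0 i j m : (0 < i)%N -> (0 < j)%N ->
  (wt m < i)%N || (wt m < j)%N -> log_term i j m = 0.
Proof.
move=> i0 j0 lt; apply/eqP; apply: contraTT lt => /(log_term_supp i0 j0).
move=> /andP[/mset_wt_mem im /mset_wt_mem jm]; rewrite negb_or -!leqNgt.
by rewrite (leq_trans _ im) ?(leq_trans _ jm) // /st_wt leq_maxl.
Qed.

Local Open Scope classical_set_scope.
Local Notation L := (fps_sum [set i | (0 < i)%N]
  (fun i => fps_sum [set j | (0 < j)%N] (log_term i))).

(** Every monomial of [log_term i j] contains both s_i and t_j, so its weight is at least [i] and at
    least [j]. *)
Lemma log_seriesE N m : (wt m <= N)%N ->
  L m = (\sum_(i < N) \sum_(j < N) log_term i.+1 j.+1) m.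
Proof.
move=> mN; rewrite (@fps_sum_posE _ _ _ N) => [|i lti]; last first.
  rewrite [LHS]fsbig1 // => j /= j0; apply: log_term_coef0 => //.
    exact: leq_ltn_trans lti.
  by rewrite (leq_ltn_trans mN lti).
rewrite fps_coef_sum; apply: eq_bigr => i _.
rewrite (@fps_sum_posE _ _ _ N) ?fps_coef_sum // => j ltj.
apply: log_term_coef0 => //; first exact: leq_ltn_trans ltj.
by rewrite (leq_ltn_trans mN ltj) orbT.
Qed.

Lemma pair_seriesE N m : (wt m <= N)%N ->
  fps_sum [set: nat] p m = (\sum_(n < N.+1) p n) m.
Proof.
move=> mN; rewrite fps_coef_sum; apply: fps_sum_natE => n lt.
by apply: homog_coef (@homog_series n) _; lia.
Qed.

Lemma mset_wt_sub (m m' : {mset nat + nat}%mset) :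
  (m' `<=` m)%mset -> (wt m' <= wt m)%N.
Proof. by move=> /msetBDK <-; rewrite mset_wtD leq_addl. Qed.

Lemma pair_series_exp : fps_sum [set: nat] p = fps_exp L.
Proof.
have L0 : L mset0 = 0 by exact: log_coef0.
apply: (fps_euler_unique st_wt_gt0) => [|m].
  rewrite fps_exp0 // (@pair_seriesE 0) ?mset_wt0 // big_ord1 comm_series0.
  by rewrite fps_coef1 eqxx.
(* The divisors of [m] have weight at most [wt m], so truncation at this bound is exact for every
   coefficient that the equations at [m] read. *)
pose N := wt m; pose G := 2%:R *: (\sum_(i < N) \sum_(a < N) g i a) : fps_st.
have wtN : (wt m <= 2 * N)%N by rewrite leq_pmull.
have sub m' : (m' `<=` m)%mset -> (wt m' <= N)%N by exact: mset_wt_sub.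
exists G; split.
- rewrite /G fps_coefZ fps_coef_sum big1 ?mulr0 // => i _.
  rewrite fps_coef_sum big1 // => a _.
  by apply: homog_coef (@homog_grid_sum i a) _; rewrite mset_wt0.
- have -> : fps_euler st_wt (fps_sum [set: nat] p) m =
      fps_euler st_wt (\sum_(n < N.+1) p n) m.
    by rewrite /fps_euler (@pair_seriesE N).
  rewrite (euler_series wtN); apply: agree_coefM => // m' /sub le.
  by rewrite (pair_seriesE le).
- rewrite fps_euler_exp //; apply: agree_coefM => // m' /sub le.
  have -> : fps_euler st_wt L m' =
      fps_euler st_wt (\sum_(i < N) \sum_(j < N) log_term i.+1 j.+1) m'.
    by rewrite /fps_euler (log_seriesE le).
  by rewrite euler_log // (leq_trans le) // leq_pmull.
Qed.

End Final.

Local Open Scope classical_set_scope.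

Theorem theorem4p1 (zeta : prim_roots) :
  fps_sum [set: nat] (fun n =>
    \sum_(la : intpartn n) \sum_(nu : intpartn n)
      (sign_partn nu * higher_lie zeta la (perm_of_partn nu) / (zcard nu)%:R)
        *: (s_mon la * t_mon nu))
  = fps_exp
      (fps_sum [set i | (0 < i)%N] (fun i =>
         fps_sum [set j | (0 < j)%N] (fun j =>
           \sum_(e <- divisors (gcdn i j))
             ((-1) ^+ (i %/ e * j.-1) * (mobius e)%:~R / (i * j %/ e)%:R)
               *: (s_ i ^+ (j %/ e) * t_ j ^+ (i %/ e))))) :> fps_st.
Proof.
rewrite -[RHS](pair_series_exp zeta); congr fps_sum; apply/funext => n.
exact: lie_side_term.
Qed.
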